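(* (Conservativity.) Let $\mathcal{L}$ be a first-order language over a countable set $\mathsf{Var}$ of variables. For every formula $A$ of $\mathcal{L}$ and every $F\in\mathcal{P}_\omega(\mathsf{Var})$ with $\mathsf{FV}(A)\subseteq F$, if the sequent $\top^F\vdash_F\kappa(F,A)$ is derivable in $\mathrm{D.FO}$, then $\vdash_{\mathrm{FO}}A$.
   Context: **First-order language.** $\mathsf{Var}=\{v_1,v_2,\dots\}$ is countable; $\mathcal{P}_\omega(\mathsf{Var})$ is the set of its finite subsets. $\mathcal{L}$ has relation symbols, function symbols (each of finite arity) and constants. Terms are as usual; formulas are $A::=R(\overline t)\mid t_1=t_2\mid\top\mid\bot\mid A\wedge A\mid A\vee A\mid A\to A\mid\forall yA\mid\exists yA$. $\mathsf{FV}$ denotes the set of free variables. For $F\in\mathcal{P}_\omega(\mathsf{Var})$, $t_F$ denotes a family $(t_v)_{v\in F}$ of terms, and $\mathsf{FV}(t_F)=\bigcup_{v\in F}\mathsf{FV}(t_v)$. If $y\notin F$, then $(s_y,t_F)$ is the family on $F\cup\{y\}$ sending $y$ to $s$ and agreeing with $t_F$ on $F$ (so in $(z_y,t_F)$ the variable $y$ is sent to the variable $z$). Sequences of distinct variables are identified with their sets of elements; $R(t_{\overline x})$ is an atomic formula whose argument list is the sequence of terms $t_{\overline x}$. $A(t_{\overline x}/\overline x)$ and $s(t_{\overline x}/\overline x)$ denote simultaneous capture-avoiding substitution, formulas of $\mathcal{L}$ being taken up to renaming of bound variables. If $\mathsf{FV}(s_T)=\overline x$, then $s(t_{\overline x}/\overline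 x)_T$ is the family $(s_v(t_{\overline x}/\overline x))_{v\in T}$. **Hilbert system $\vdash_{\mathrm{FO}}$.** Axioms: propositional tautologies; $\forall x(B\to C)\to(\forall xB\to\forall xC)$; $B\to\forall xB$ with $x\notin\mathsf{FV}(B)$; $\forall xB\to B(t/x)$; $t=t$; $s=t\to(A(s/x)\to A(t/x))$; all universal closures of instances of these. Rule: modus ponens. It is sound and complete for the usual first-order models with nonempty domain (with $\exists$ understood as usual). **Multi-type formulas.** For each type $F\in\mathcal{P}_\omega(\mathsf{Var})$ the set $\mathcal{L}_F$ of formulas of type $F$ is given by simultaneous induction: $R(t_{\overline x})$ with $\mathsf{FV}(t_{\overline x})=F$; $s=t$ with $\mathsf{FV}(s)\cup\mathsf{FV}(t)=F$; $\top^F$, $\bot^F$; $A\wedge B$, $A\vee B$, $A\to B$ with $A,B\in\mathcal{L}_F$; $[y]A$ and $\langle y\rangle A$ with $y\notin F$, $A\in\mathcal{L}_{F\cup\{y\}}$; $(x)A$ with $x\in F$, $A\in\mathcal{L}_{F\setminus\{x\}}$; $(t_{F'})A$ with $A\in\mathcal{L}_{F'}$ and $\mathsf{FV}(t_{F'})=F$. $\mathcal{L}_{\mathrm{MT}}=\bigcup_F\mathcal{L}_F$. The translation $(\cdot)^\tau:\mathcal{L}_{\mathrm{MT}}\to\mathcal{L}$ is the identity on atomic formulas, sends $\top^F,\bot^F$ to $\top,\bot$, commutes with $\wedge,\vee,\to$, and $([y]A)^\tau=\forall yA^\tau$, $(\langle y\rangle A)^\tau=\exists yA^\tau$, $((x)A)^\tau=A^\tau$,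 $((t_{F'})A)^\tau=A^\tau(t_{F'}/F')$. **The map $\kappa$.** $\kappa(F,A)\in\mathcal{L}_{F\cup\mathsf{FV}(A)}$ is defined by recursion on $A\in\mathcal{L}$ for $F\in\mathcal{P}_\omega(\mathsf{Var})$: $\kappa(F,A)=(z_1)\cdots(z_k)A$ for $A$ atomic ($R(t_{\overline x})$ or $s=t$), where $\{z_1,\dots,z_k\}=F\setminus\mathsf{FV}(A)$ (listed in some fixed order); $\kappa(F,\top)=\top^F$, $\kappa(F,\bot)=\bot^F$; $\kappa(F,A\bullet B)=\kappa(F\cup\mathsf{FV}(B),A)\bullet\kappa(F\cup\mathsf{FV}(A),B)$ for $\bullet\in\{\wedge,\vee,\to\}$; $\kappa(F,\exists xA)=(x)\langle x\rangle\kappa(F,A)$ if $x\in F$ and $\langle x\rangle\kappa(F\cup\{x\},A)$ if $x\notin F$; $\kappa(F,\forall xA)=(x)[x]\kappa(F,A)$ if $x\in F$ and $[x]\kappa(F\cup\{x\},A)$ if $x\notin F$. **Structures and sequents.** Precedent structures of each type: formulas, $\hat\top_F$, $\hat R(t_{\overline x})$ (type $\mathsf{FV}(t_{\overline x})$), $s\,\hat=\,t$ (type $\mathsf{FV}(s)\cup\mathsf{FV}(t)$), $X\hat\wedge X'$, $Y\hat\succ X$, $X\hat\prec Y$, $\langle\hat x\rangle X$, $(\tilde x)X$, $(\tilde t_{F})X$, $\langle\hat t_F\rangle X$, where $X,X'$ are precedent and $Y$ succedent structures. Succedent structures: formulas, $\check\bot_F$, $Y\check\vee Y'$, $X\check\to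 Y$, $Y\check\leftarrow X$, $[\check x]Y$, $(\tilde x)Y$, $(\tilde t_F)Y$, $[\check t_F]Y$, where $X$ is precedent, $Y,Y'$ are succedent. Binary connectives combine structures of one and the same type. $\langle\hat x\rangle,[\check x]$ take type $F\cup\{x\}$ to $F\setminus\{x\}$; $(\tilde x)$ takes type $F\setminus\{x\}$ to $F\cup\{x\}$; $(\tilde t_F)$ takes type $F$ to $\mathsf{FV}(t_F)$; $\langle\hat t_F\rangle,[\check t_F]$ take type $\mathsf{FV}(t_F)$ to $F$. A sequent $X\vdash_F Y$ has $X$ precedent and $Y$ succedent, both of type $F$. **Rules of $\mathrm{D.FO}$** (premises / conclusion; ''//'' means the rule may be used in both directions; all sequents well-formed and well-typed). 1. Identity: $\hat R(t_{\overline x})\vdash R(t_{\overline x})$; $s\,\hat=\,t\vdash s=t$. Cut: $X\vdash_F A$ and $A\vdash_F Y$ / $X\vdash_F Y$. 2. $X\hat\wedge Y\vdash Z$ // $Y\vdash X\check\to Z$; $X\hat\wedge Y\vdash Z$ // $X\vdash Z\check\leftarrow Y$; $Z\vdash X\check\vee Y$ // $X\hat\succ Z\vdash Y$; $Z\vdash X\check\vee Y$ // $Z\hat\prec Y\vdash X$. 3. $X\vdash_{F\cup\{x\}}(\tilde x)Y$ // $\langle\hat x\rangle X\vdash_{F\setminus\{x\}}Y$; $(\tilde x)Y\vdash_{F\cup\{x\}}X$ // $Y\vdash_{F\setminus\{x\}}[\check x]X$. 4. With $F'=\mathsf{FV}(t_F)$: $Y\vdash_{F'}(\tilde t_F)X$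 // $\langle\hat t_F\rangle Y\vdash_F X$; $(\tilde t_F)X\vdash_{F'}Y$ // $X\vdash_F[\check t_F]Y$. 5. $(\tilde x)\langle\hat x\rangle X\vdash Y$ / $X\vdash Y$; $(\tilde t_{F'})\langle\hat t_{F'}\rangle X\vdash Y$ / $X\vdash Y$. 6. $\hat\top_{F\cup\{x\}}\vdash X$ // $(\tilde x)\hat\top_{F\setminus\{x\}}\vdash X$; $X\vdash\check\bot_{F\cup\{x\}}$ // $X\vdash(\tilde x)\check\bot_{F\setminus\{x\}}$. 7. With $\mathsf{FV}(t_{F'})=F$: $\hat\top_F\vdash X$ // $(\tilde t_{F'})\hat\top_{F'}\vdash X$; $X\vdash\check\bot_F$ // $X\vdash(\tilde t_{F'})\check\bot_{F'}$. 8. $(\tilde s_{T_1})\cdots(\tilde s_{T_m})\hat R(s_{\overline x})\vdash X$ / $(\tilde t_{F_1})\cdots(\tilde t_{F_k})\hat R(t_{\overline x})\vdash X$, provided $((t_{F_1})\cdots(t_{F_k})R(t_{\overline x}))^\tau=((s_{T_1})\cdots(s_{T_m})R(s_{\overline x}))^\tau$; and $(\tilde s_{T_1})\cdots(\tilde s_{T_m})(r_3\,\hat=\,r_4)\vdash X$ / $(\tilde t_{F_1})\cdots(\tilde t_{F_k})(r_1\,\hat=\,r_2)\vdash X$, provided $((t_{F_1})\cdots(t_{F_k})\,r_1=r_2)^\tau=((s_{T_1})\cdots(s_{T_m})\,r_3=r_4)^\tau$. 9. $X\vdash Y$ // $\hat\top\hat\wedge X\vdash Y$; $Y\vdash X$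 // $Y\vdash X\check\vee\check\bot$; exchange: $Y\hat\wedge X\vdash Z$ / $X\hat\wedge Y\vdash Z$ and $Z\vdash X\check\vee Y$ / $Z\vdash Y\check\vee X$; weakening: $Y\vdash Z$ / $X\hat\wedge Y\vdash Z$ and $Z\vdash Y$ / $Z\vdash Y\check\vee X$; contraction: $X\hat\wedge X\vdash Y$ / $X\vdash Y$ and $Y\vdash X\check\vee X$ / $Y\vdash X$; associativity: $X\hat\wedge(Y\hat\wedge Z)\vdash W$ // $(X\hat\wedge Y)\hat\wedge Z\vdash W$ and $W\vdash(Z\check\vee Y)\check\vee X$ // $W\vdash Z\check\vee(Y\check\vee X)$. 10. Equality: $(t\,\hat=\,t)\hat\wedge X\vdash Y$ / $X\vdash Y$; and $(\tilde x_1)\cdots(\tilde x_n)(t\,\hat=\,s)\vdash(\tilde y_1)\cdots(\tilde y_m)(\widetilde{t_y,r_F})X$ / $(\tilde x_1)\cdots(\tilde x_n)(t\,\hat=\,s)\vdash(\tilde z_1)\cdots(\tilde z_k)(\widetilde{s_y,r_F})X$, where $\{x_i\}=\mathsf{FV}(r_F)\setminus\mathsf{FV}(t,s)$, $\{y_i\}=\mathsf{FV}(s)\setminus\mathsf{FV}(t,r_F)$, $\{z_i\}=\mathsf{FV}(t)\setminus\mathsf{FV}(s,r_F)$. 11. $\hat R(s_{\overline x})\vdash X$ / $R(s_{\overline x})\vdash X$; $s\,\hat=\,t\vdash X$ / $s=t\vdash X$. 12. $\bot\vdash\check\bot$; $X\vdash\check\bot$ / $X\vdash\bot$; $\hat\top\vdash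 X$ / $\top\vdash X$; $\hat\top\vdash\top$; $A\hat\wedge B\vdash X$ / $A\wedge B\vdash X$; $X\vdash A$ and $Y\vdash B$ / $X\hat\wedge Y\vdash A\wedge B$; $A\vdash X$ and $B\vdash Y$ / $A\vee B\vdash X\check\vee Y$; $X\vdash A\check\vee B$ / $X\vdash A\vee B$; $X\vdash A$ and $B\vdash Y$ / $A\to B\vdash X\check\to Y$; $X\vdash A\check\to B$ / $X\vdash A\to B$. 13. Grishin: $X\hat\succ(Y\hat\wedge Z)\vdash W$ / $(X\hat\succ Y)\hat\wedge Z\vdash W$; $W\vdash X\check\to(Y\check\vee Z)$ / $W\vdash(X\check\to Y)\check\vee Z$. 14. $\langle\hat x\rangle A\vdash X$ / $\langle x\rangle A\vdash X$; $X\vdash A$ / $\langle\hat x\rangle X\vdash\langle x\rangle A$; $A\vdash X$ / $[x]A\vdash[\check x]X$; $X\vdash[\check x]A$ / $X\vdash[x]A$; $(\tilde x)A\vdash X$ / $(x)A\vdash X$; $X\vdash(\tilde x)A$ / $X\vdash(x)A$; $(\tilde t_{F'})A\vdash X$ / $(t_{F'})A\vdash X$; $X\vdash(\tilde t_{F'})A$ / $X\vdash(t_{F'})A$. 15. $X\vdash_{F\setminus\{x\}}Y$ // $(\tilde x)X\vdash_{F\cup\{x\}}(\tilde x)Y$; $X\vdash_{F'}Y$ / $(\tilde t_{F'})X\vdash_F(\tilde t_{F'})Y$. 16. For $\star$ either $\tilde x$ or $\tilde t_F$: $(\star)X\,\hat\circ\,(\star)Y\vdash Z$ // $(\star)(X\,\hat\circ\,Y)\vdash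 Z$ for $\hat\circ\in\{\hat\wedge,\hat\succ,\hat\prec\}$; $Z\vdash(\star)X\,\check\circ\,(\star)Y$ // $Z\vdash(\star)(X\,\check\circ\,Y)$ for $\check\circ\in\{\check\vee,\check\to,\check\leftarrow\}$. 17. With $x\neq y$: $(\tilde x)\langle\hat y\rangle X\vdash Y$ // $\langle\hat y\rangle(\tilde x)X\vdash Y$; $Y\vdash(\tilde x)[\check y]X$ // $Y\vdash[\check y](\tilde x)X$; $(\tilde x)(\tilde y)X\vdash Y$ // $(\tilde y)(\tilde x)X\vdash Y$; $Y\vdash(\tilde x)(\tilde y)X$ // $Y\vdash(\tilde y)(\tilde x)X$. With $z\notin\mathsf{FV}(t_{F'})\cup F'$: $(\tilde t_{F'})\langle\hat y\rangle X\vdash Y$ // $\langle\hat z\rangle(\widetilde{z_y,t_{F'}})X\vdash Y$; $Y\vdash(\tilde t_{F'})[\check y]X$ // $Y\vdash[\check z](\widetilde{z_y,t_{F'}})X$. With $\overline x=F=\mathsf{FV}(s_{F'})$: $(\tilde t_F)(\tilde s_{F'})X\vdash Y$ // $(\widetilde{s(t_{\overline x}/\overline x)}_{F'})X\vdash Y$; $Y\vdash(\tilde t_F)(\tilde s_{F'})X$ // $Y\vdash(\widetilde{s(t_{\overline x}/\overline x)}_{F'})X$. With $\{z_1,\dots,z_k\}=\mathsf{FV}(s)\setminus\mathsf{FV}(t_F)$: $(\widetilde{s_y,t_F})(\tilde y)X\vdash Y$ // $(\tilde z_1)\cdots(\tilde z_k)(\tilde t_F)X\vdash Y$; $Y\vdash(\widetilde{s_y,t_F})(\tilde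 y)X$ // $Y\vdash(\tilde z_1)\cdots(\tilde z_k)(\tilde t_F)X$. *)

(* Defs.v *)
From mathcomp Require Import all_boot.
From mathcomp Require Import finmap.
From Stdlib Require List.

Set Implicit Arguments.
Unset Strict Implicit.
Unset Printing Implicit Defensive.

Local Open Scope fset_scope.
Local Open Scope fmap_scope.

(* The countable set Var, identified with nat. *)
Notation var := nat.

Record signature := Signature {
  rel_sym : Type;
  rel_ar : rel_sym -> nat;
  fun_sym : Type;
  fun_ar : fun_sym -> nat;
  cst_sym : Type
}.

Section Language.

Variable L : signature.

(** * First-order syntax *)

Inductive term : Type :=
| TVar (v : var)
| TCst (c : cst_sym L)
| TFun (f : fun_sym L) (a : {ffun 'I_(fun_ar f) -> term}).

(* Raw formulas with named bound variables; "up to renaming" is [aeq]. *)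
Inductive form : Type :=
| FRel (R : rel_sym L) (a : {ffun 'I_(rel_ar R) -> term})
| FEq (s t : term)
| FTop
| FBot
| FAnd (A B : form)
| FOr (A B : form)
| FImp (A B : form)
| FAll (x : var) (A : form)
| FEx (x : var) (A : form).

(* A family (t_v) for v in F; F is [domf t], and (s_y, t_F) is [t.[y <- s]]. *)
Definition family := {fmap var -> term}.

Fixpoint fv_term (t : term) : {fset var} :=
  match t with
  | TVar v => [fset v]
  | TCst _ => fset0
  | TFun f a => \bigcup_(i in 'I_(fun_ar f)) fv_term (a i)
  end.

Definition fv_args n (a : {ffun 'I_n -> term}) : {fset var} :=
  \bigcup_(i in 'I_n) fv_term (a i).

Definition fv_fam (t : family) : {fset var} :=
  \bigcup_(v in {: domf t}) fv_term (t v).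

Fixpoint fv (A : form) : {fset var} :=
  match A with
  | FRel _ a => fv_args a
  | FEq s t => fv_term s `|` fv_term t
  | FTop | FBot => fset0
  | FAnd A B | FOr A B | FImp A B => fv A `|` fv B
  | FAll x A | FEx x A => fv A `\ x
  end.

(** * Simultaneous substitution *)

(* Variables outside [domf t] are left unchanged. *)
Definition subst_var (t : family) (v : var) : term := odflt (TVar v) t.[? v].

Fixpoint subst_term (t : family) (s : term) : term :=
  match s with
  | TVar v => subst_var t v
  | TCst c => TCst c
  | TFun _ a => TFun [ffun i => subst_term t (a i)]
  end.

Definition subst_args n (t : family) (a : {ffun 'I_n -> term}) :
  {ffun 'I_n -> term} := [ffun i => subst_term t (a i)].

Definition subst_fam (t s : family) : family :=
  [fmap v : domf s => subst_term t (s v)].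

(* The name of a binder x, whose scope has the other free variables V, after
   substitution of t: x itself unless it would capture a variable. *)
Definition rebind (t : family) (x : var) (V : {fset var}) : var :=
  let W := \bigcup_(v <- V) fv_term (subst_var t v) in
  if x \in W then (\max_(w <- W) w).+1 else x.

Fixpoint subst (t : family) (A : form) : form :=
  match A with
  | FRel _ a => FRel (subst_args t a)
  | FEq s1 s2 => FEq (subst_term t s1) (subst_term t s2)
  | FTop => FTop
  | FBot => FBot
  | FAnd A B => FAnd (subst t A) (subst t B)
  | FOr A B => FOr (subst t A) (subst t B)
  | FImp A B => FImp (subst t A) (subst t B)
  | FAll x A => let z := rebind t x (fv A `\ x) in
                FAll z (subst t.[x <- TVar z] A)
  | FEx x A => let z := rebind t x (fv A `\ x) in
               FEx z (subst t.[x <- TVar z] A)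
  end.

(* A(t/x) *)
Definition subst1 (A : form) (t : term) (x : var) : form :=
  subst [fmap].[x <- t] A.

Inductive aeq : form -> form -> Prop :=
| aeq_refl A : aeq A A
| aeq_sym A B : aeq A B -> aeq B A
| aeq_trans A B C : aeq A B -> aeq B C -> aeq A C
| aeq_and A A' B B' : aeq A A' -> aeq B B' -> aeq (FAnd A B) (FAnd A' B')
| aeq_or A A' B B' : aeq A A' -> aeq B B' -> aeq (FOr A B) (FOr A' B')
| aeq_imp A A' B B' : aeq A A' -> aeq B B' -> aeq (FImp A B) (FImp A' B')
| aeq_all x A A' : aeq A A' -> aeq (FAll x A) (FAll x A')
| aeq_ex x A A' : aeq A A' -> aeq (FEx x A) (FEx x A')
| aeq_rename_all x y A : y \notin fv A ->
    aeq (FAll x A) (FAll y (subst1 A (TVar y) x))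
| aeq_rename_ex x y A : y \notin fv A ->
    aeq (FEx x A) (FEx y (subst1 A (TVar y) x)).

(** * The Hilbert system *)

(* Atomic and quantified formulas play the role of propositional variables. *)
Fixpoint prop_eval (val : form -> bool) (A : form) : bool :=
  match A with
  | FTop => true
  | FBot => false
  | FAnd A B => prop_eval val A && prop_eval val B
  | FOr A B => prop_eval val A || prop_eval val B
  | FImp A B => prop_eval val A ==> prop_eval val B
  | FRel _ _ | FEq _ _ | FAll _ _ | FEx _ _ => val A
  end.

Definition tautology (A : form) : Prop := forall val, prop_eval val A.

Definition FNot (A : form) : form := FImp A FBot.

(* [ax_ex] expresses that the existential quantifier is understood as usual;
   [ax_gen] adds universal closures, i.e. arbitrary universal prefixes. *)
Inductive fo_axiom : form -> Prop :=
| ax_taut A : tautology A -> fo_axiom A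
| ax_dist x B C :
    fo_axiom (FImp (FAll x (FImp B C)) (FImp (FAll x B) (FAll x C)))
| ax_vac x B : x \notin fv B -> fo_axiom (FImp B (FAll x B))
| ax_inst x t B : fo_axiom (FImp (FAll x B) (subst1 B t x))
| ax_refl t : fo_axiom (FEq t t)
| ax_leibniz s t x A :
    fo_axiom (FImp (FEq s t) (FImp (subst1 A s x) (subst1 A t x)))
| ax_ex x B :
    fo_axiom (FAnd (FImp (FEx x B) (FNot (FAll x (FNot B))))
                   (FImp (FNot (FAll x (FNot B))) (FEx x B)))
| ax_gen x A : fo_axiom A -> fo_axiom (FAll x A).

(* [fo_alpha] makes provability a predicate on formulas up to renaming. *)
Inductive fo_provable : form -> Prop :=
| fo_ax A : fo_axiom A -> fo_provable A
| fo_mp A B : fo_provable (FImp A B) -> fo_provable A -> fo_provable B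
| fo_alpha A B : aeq A B -> fo_provable A -> fo_provable B.

(** * Multi-type formulas *)

Inductive mtform : Type :=
| MRel (R : rel_sym L) (a : {ffun 'I_(rel_ar R) -> term})
| MEq (s t : term)
| MTop (F : {fset var})
| MBot (F : {fset var})
| MAnd (A B : mtform)
| MOr (A B : mtform)
| MImp (A B : mtform)
| MAll (y : var) (A : mtform)             (* [y]A *)
| MEx (y : var) (A : mtform)              (* <y>A *)
| MCyl (x : var) (A : mtform)             (* (x)A *)
| MSub (t : family) (A : mtform).         (* (t_F)A *)

(* [mt_typed F A]: A belongs to L_F. *)
Inductive mt_typed : {fset var} -> mtform -> Prop :=
| mt_rel R a : mt_typed (fv_args a) (@MRel R a)
| mt_eq s t : mt_typed (fv_term s `|` fv_term t) (MEq s t)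
| mt_top F : mt_typed F (MTop F)
| mt_bot F : mt_typed F (MBot F)
| mt_and F A B : mt_typed F A -> mt_typed F B -> mt_typed F (MAnd A B)
| mt_or F A B : mt_typed F A -> mt_typed F B -> mt_typed F (MOr A B)
| mt_imp F A B : mt_typed F A -> mt_typed F B -> mt_typed F (MImp A B)
| mt_all F y A : y \notin F -> mt_typed (y |` F) A -> mt_typed F (MAll y A)
| mt_ex F y A : y \notin F -> mt_typed (y |` F) A -> mt_typed F (MEx y A)
| mt_cyl F x A : x \in F -> mt_typed (F `\ x) A -> mt_typed F (MCyl x A)
| mt_sub t A : mt_typed (domf t) A -> mt_typed (fv_fam t) (MSub t A).

Fixpoint tau (A : mtform) : form :=
  match A with
  | MRel _ a => FRel a
  | MEq s t => FEq s t
  | MTop _ => FTop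
  | MBot _ => FBot
  | MAnd A B => FAnd (tau A) (tau B)
  | MOr A B => FOr (tau A) (tau B)
  | MImp A B => FImp (tau A) (tau B)
  | MAll y A => FAll y (tau A)
  | MEx y A => FEx y (tau A)
  | MCyl _ A => tau A
  | MSub t A => subst t (tau A)
  end.

(* (z_1)...(z_k)A, the fixed order being the increasing one. *)
Definition mt_pad (F : {fset var}) (A : mtform) : mtform :=
  foldr MCyl A (sort leq F).

Fixpoint kappa (F : {fset var}) (A : form) : mtform :=
  match A with
  | FRel _ a => mt_pad (F `\` fv A) (MRel a)
  | FEq s t => mt_pad (F `\` fv A) (MEq s t)
  | FTop => MTop F
  | FBot => MBot F
  | FAnd A B => MAnd (kappa (F `|` fv B) A) (kappa (F `|` fv A) B)
  | FOr A B => MOr (kappa (F `|` fv B) A) (kappa (F `|` fv A) B)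
  | FImp A B => MImp (kappa (F `|` fv B) A) (kappa (F `|` fv A) B)
  | FEx x A => if x \in F then MCyl x (MEx x (kappa F A))
               else MEx x (kappa (x |` F) A)
  | FAll x A => if x \in F then MCyl x (MAll x (kappa F A))
                else MAll x (kappa (x |` F) A)
  end.

Lemma mt_pad_typed (G : {fset var}) (A : mtform) (F : {fset var}) :
  mt_typed F A -> [disjoint F & G]%fset -> mt_typed (F `|` G) (mt_pad G A).
Proof.
rewrite /mt_pad => HA.
have : uniq (sort leq G) by rewrite sort_uniq fset_uniq.
have -> : F `|` G = F `|` [fset x in sort leq G].
  by congr (_ `|` _); apply/fsetP=> x; rewrite !inE mem_sort.
have -> : [disjoint F & G]%fset = all (fun x => x \notin F) (sort leq G).
  rewrite all_sort; apply/fdisjointP/allP => [H x xG|H x xF].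
    by apply/negP => /H; rewrite xG.
  by apply/negP => /H; rewrite xF.
elim: (sort leq G) => [|x s IH] /=.
  by move=> _ _; rewrite (_ : F `|` _ = F) //; apply/fsetP=> x; rewrite !inE orbF.
move=> /andP[xs us] /andP[xF sF].
apply: mt_cyl; first by rewrite !inE eqxx orbT.
rewrite (_ : _ `\ x = F `|` [fset x in s]); first exact: IH.
apply/fsetP=> y; rewrite !inE; case: eqP => [->|] //=.
by rewrite (negPf xF) (negPf xs).
Qed.

Lemma kappa_typed (F : {fset var}) (A : form) :
  mt_typed (F `|` fv A) (kappa F A).
Proof.
have pad K G (B : mtform) : mt_typed G B -> mt_typed (K `|` G) (mt_pad (K `\` G) B).
  move=> H; rewrite (_ : K `|` G = G `|` (K `\` G)); last first.
    by apply/fsetP=> x; rewrite !inE; do 2 case: (x \in _).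
  by apply: mt_pad_typed => //; apply/fdisjointP=> x xG; rewrite !inE xG.
have eq1 (K G H : {fset var}) : K `|` (G `|` H) = (K `|` H) `|` G.
  by rewrite (fsetUC G) fsetUA.
elim: A F => /= [R a|s t|||A IA B IB|A IA B IB|A IA B IB|x A IA|x A IA] F.
- by apply: pad; constructor.
- by apply: pad; constructor.
- by rewrite fsetU0; constructor.
- by rewrite fsetU0; constructor.
1-3: by constructor; [rewrite eq1|rewrite fsetUA].
all: case: ifP => xF.
1,3: have -> : F `|` (fv A `\ x) = F `|` fv A by
  apply/fsetP=> y; rewrite !inE; case: eqP => [->|] //=; rewrite xF.
1,2: apply: mt_cyl; [by rewrite !inE xF|];
  constructor; [by rewrite !inE eqxx|];
  rewrite (_ : x |` _ = F `|` fv A); [exact: IA|];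
  by apply/fsetP=> y; rewrite !inE; case: eqP => [->|] //=; rewrite xF.
all: constructor; [by rewrite !inE xF eqxx|];
  rewrite (_ : x |` _ = (x |` F) `|` fv A); [exact: IA|];
  by apply/fsetP=> y; rewrite !inE; case: eqP => [->|].
Qed.

(** * Structures and sequents *)

(* A hat (resp. check) connective of the display calculus is rendered by the
   prefix P (resp. S); PCyl/SCyl and PSub/SSub are the tilde connectives. *)
Inductive pstr : Type :=
| PForm (A : mtform)
| PTop (F : {fset var})
| PRel (R : rel_sym L) (a : {ffun 'I_(rel_ar R) -> term})
| PEq (s t : term)
| PAnd (X X' : pstr)
| PSucc (Y : sstr) (X : pstr)             (* Y ≻ X *)
| PPrec (X : pstr) (Y : sstr)             (* X ≺ Y *)
| PEx (x : var) (X : pstr)                (* <x>X *)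
| PCyl (x : var) (X : pstr)               (* (x)X *)
| PSub (t : family) (X : pstr)            (* (t_F)X *)
| PExSub (t : family) (X : pstr)          (* <t_F>X *)
with sstr : Type :=
| SForm (A : mtform)
| SBot (F : {fset var})
| SOr (Y Y' : sstr)
| SImp (X : pstr) (Y : sstr)              (* X → Y *)
| SPmi (Y : sstr) (X : pstr)              (* Y ← X *)
| SAll (x : var) (Y : sstr)               (* [x]Y *)
| SCyl (x : var) (Y : sstr)               (* (x)Y *)
| SSub (t : family) (Y : sstr)            (* (t_F)Y *)
| SAllSub (t : family) (Y : sstr).        (* [t_F]Y *)

Inductive p_typed : {fset var} -> pstr -> Prop :=
| pt_form F A : mt_typed F A -> p_typed F (PForm A)
| pt_top F : p_typed F (PTop F)
| pt_rel R a : p_typed (fv_args a) (@PRel R a)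
| pt_eq s t : p_typed (fv_term s `|` fv_term t) (PEq s t)
| pt_and F X X' : p_typed F X -> p_typed F X' -> p_typed F (PAnd X X')
| pt_succ F Y X : s_typed F Y -> p_typed F X -> p_typed F (PSucc Y X)
| pt_prec F X Y : p_typed F X -> s_typed F Y -> p_typed F (PPrec X Y)
| pt_ex F x X : p_typed (x |` F) X -> p_typed (F `\ x) (PEx x X)
| pt_cyl F x X : p_typed (F `\ x) X -> p_typed (x |` F) (PCyl x X)
| pt_sub t X : p_typed (domf t) X -> p_typed (fv_fam t) (PSub t X)
| pt_exsub t X : p_typed (fv_fam t) X -> p_typed (domf t) (PExSub t X)
with s_typed : {fset var} -> sstr -> Prop :=
| st_form F A : mt_typed F A -> s_typed F (SForm A)
| st_bot F : s_typed F (SBot F)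
| st_or F Y Y' : s_typed F Y -> s_typed F Y' -> s_typed F (SOr Y Y')
| st_imp F X Y : p_typed F X -> s_typed F Y -> s_typed F (SImp X Y)
| st_pmi F Y X : s_typed F Y -> p_typed F X -> s_typed F (SPmi Y X)
| st_all F x Y : s_typed (x |` F) Y -> s_typed (F `\ x) (SAll x Y)
| st_cyl F x Y : s_typed (F `\ x) Y -> s_typed (x |` F) (SCyl x Y)
| st_sub t Y : s_typed (domf t) Y -> s_typed (fv_fam t) (SSub t Y)
| st_allsub t Y : s_typed (fv_fam t) Y -> s_typed (domf t) (SAllSub t Y).

Record sequent := Sequent {
  sq_type : {fset var};
  sq_left : pstr;
  sq_right : sstr
}.

Definition sq_typed (S : sequent) : Prop :=
  p_typed (sq_type S) (sq_left S) /\ s_typed (sq_type S) (sq_right S).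

Local Notation "X ⊢[ F ] Y" := (Sequent F X Y)
  (at level 70, F at level 200, no associativity).

(** * The rules of D.FO *)

Definition pcyls (xs : seq var) (X : pstr) : pstr := foldr PCyl X xs.
Definition scyls (xs : seq var) (Y : sstr) : sstr := foldr SCyl Y xs.
Definition psubs (ts : seq family) (X : pstr) : pstr := foldr PSub X ts.
Definition msubs (ts : seq family) (A : mtform) : mtform := foldr MSub A ts.

(* In the rules below [perm_eq xs S] says that xs lists the elements of the
   finite set S, without repetition, in some order. *)

(* The tilde operators x~ and t~. *)
Variant tilde : Type := TildeVar (x : var) | TildeSub (t : family).

Definition ptilde (o : tilde) (X : pstr) : pstr :=
  match o with TildeVar x => PCyl x X | TildeSub t => PSub t X end.
Definition stilde (o : tilde) (Y : sstr) : sstr :=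
  match o with TildeVar x => SCyl x Y | TildeSub t => SSub t Y end.

(* The rules usable in both directions. *)
Inductive birule : sequent -> sequent -> Prop :=
(* display postulates *)
| b_and_imp F X Y Z : birule (PAnd X Y ⊢[F] Z) (Y ⊢[F] SImp X Z)
| b_and_pmi F X Y Z : birule (PAnd X Y ⊢[F] Z) (X ⊢[F] SPmi Z Y)
| b_or_succ F X Y Z : birule (Z ⊢[F] SOr X Y) (PSucc X Z ⊢[F] Y)
| b_or_prec F X Y Z : birule (Z ⊢[F] SOr X Y) (PPrec Z Y ⊢[F] X)
| b_adj_ex F x X Y :
    birule (X ⊢[x |` F] SCyl x Y) (PEx x X ⊢[F `\ x] Y)
| b_adj_all F x X Y :
    birule (PCyl x Y ⊢[x |` F] X) (Y ⊢[F `\ x] SAll x X)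
| b_adj_exsub t X Y :
    birule (Y ⊢[fv_fam t] SSub t X) (PExSub t Y ⊢[domf t] X)
| b_adj_allsub t X Y :
    birule (PSub t X ⊢[fv_fam t] Y) (X ⊢[domf t] SAllSub t Y)
(* units and tilde operators *)
| b_top_cyl F x X :
    birule (PTop (x |` F) ⊢[x |` F] X) (PCyl x (PTop (F `\ x)) ⊢[x |` F] X)
| b_bot_cyl F x X :
    birule (X ⊢[x |` F] SBot (x |` F)) (X ⊢[x |` F] SCyl x (SBot (F `\ x)))
| b_top_sub t X :
    birule (PTop (fv_fam t) ⊢[fv_fam t] X)
           (PSub t (PTop (domf t)) ⊢[fv_fam t] X)
| b_bot_sub t X :
    birule (X ⊢[fv_fam t] SBot (fv_fam t))
           (X ⊢[fv_fam t] SSub t (SBot (domf t)))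
(* units and associativity *)
| b_top_and F X Y : birule (X ⊢[F] Y) (PAnd (PTop F) X ⊢[F] Y)
| b_or_bot F X Y : birule (Y ⊢[F] X) (Y ⊢[F] SOr X (SBot F))
| b_and_assoc F X Y Z W :
    birule (PAnd X (PAnd Y Z) ⊢[F] W) (PAnd (PAnd X Y) Z ⊢[F] W)
| b_or_assoc F X Y Z W :
    birule (W ⊢[F] SOr (SOr Z Y) X) (W ⊢[F] SOr Z (SOr Y X))
(* cylindrification reflects entailment *)
| b_cyl F x X Y :
    birule (X ⊢[F `\ x] Y) (PCyl x X ⊢[x |` F] SCyl x Y)
(* distribution of the tilde operators *)
| b_dist_and F o X Y Z :
    birule (PAnd (ptilde o X) (ptilde o Y) ⊢[F] Z)
           (ptilde o (PAnd X Y) ⊢[F] Z)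
| b_dist_succ F o X Y Z :
    birule (PSucc (stilde o X) (ptilde o Y) ⊢[F] Z)
           (ptilde o (PSucc X Y) ⊢[F] Z)
| b_dist_prec F o X Y Z :
    birule (PPrec (ptilde o X) (stilde o Y) ⊢[F] Z)
           (ptilde o (PPrec X Y) ⊢[F] Z)
| b_dist_or F o X Y Z :
    birule (Z ⊢[F] SOr (stilde o X) (stilde o Y))
           (Z ⊢[F] stilde o (SOr X Y))
| b_dist_imp F o X Y Z :
    birule (Z ⊢[F] SImp (ptilde o X) (stilde o Y))
           (Z ⊢[F] stilde o (SImp X Y))
| b_dist_pmi F o X Y Z :
    birule (Z ⊢[F] SPmi (stilde o X) (ptilde o Y))
           (Z ⊢[F] stilde o (SPmi X Y))
(* interaction of quantifiers, cylindrifications and substitutions *)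
| b_cyl_ex F x y X Y : x != y ->
    birule (PCyl x (PEx y X) ⊢[F] Y) (PEx y (PCyl x X) ⊢[F] Y)
| b_cyl_all F x y X Y : x != y ->
    birule (Y ⊢[F] SCyl x (SAll y X)) (Y ⊢[F] SAll y (SCyl x X))
| b_cyl_cyl_l F x y X Y : x != y ->
    birule (PCyl x (PCyl y X) ⊢[F] Y) (PCyl y (PCyl x X) ⊢[F] Y)
| b_cyl_cyl_r F x y X Y : x != y ->
    birule (Y ⊢[F] SCyl x (SCyl y X)) (Y ⊢[F] SCyl y (SCyl x X))
| b_sub_ex F t y z X Y :
    y \notin domf t -> z \notin fv_fam t `|` domf t ->
    birule (PSub t (PEx y X) ⊢[F] Y)
           (PEx z (PSub t.[y <- TVar z] X) ⊢[F] Y)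
| b_sub_all F t y z X Y :
    y \notin domf t -> z \notin fv_fam t `|` domf t ->
    birule (Y ⊢[F] SSub t (SAll y X))
           (Y ⊢[F] SAll z (SSub t.[y <- TVar z] X))
| b_sub_sub_l F t s X Y : domf t = fv_fam s ->
    birule (PSub t (PSub s X) ⊢[F] Y) (PSub (subst_fam t s) X ⊢[F] Y)
| b_sub_sub_r F t s X Y : domf t = fv_fam s ->
    birule (Y ⊢[F] SSub t (SSub s X)) (Y ⊢[F] SSub (subst_fam t s) X)
| b_sub_cyl_l F t s y zs X Y :
    y \notin domf t -> perm_eq zs (fv_term s `\` fv_fam t) ->
    birule (PSub t.[y <- s] (PCyl y X) ⊢[F] Y)
           (pcyls zs (PSub t X) ⊢[F] Y)
| b_sub_cyl_r F t s y zs X Y :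
    y \notin domf t -> perm_eq zs (fv_term s `\` fv_fam t) ->
    birule (Y ⊢[F] SSub t.[y <- s] (SCyl y X))
           (Y ⊢[F] scyls zs (SSub t X)).

Inductive rule : seq sequent -> sequent -> Prop :=
| r_down p c : birule p c -> rule [:: p] c
| r_up p c : birule p c -> rule [:: c] p
(* identity and cut *)
| r_id_rel F R a : rule [::] (PRel a ⊢[F] SForm (@MRel R a))
| r_id_eq F s t : rule [::] (PEq s t ⊢[F] SForm (MEq s t))
| r_cut F X A Y :
    rule [:: X ⊢[F] SForm A; PForm A ⊢[F] Y] (X ⊢[F] Y)
(* units of the adjunctions *)
| r_cyl_ex F x X Y : rule [:: PCyl x (PEx x X) ⊢[F] Y] (X ⊢[F] Y)
| r_sub_exsub F t X Y : rule [:: PSub t (PExSub t X) ⊢[F] Y] (X ⊢[F] Y)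
(* atomic formulas with the same translation *)
| r_atom_rel F R (a b : {ffun 'I_(rel_ar R) -> term}) ts ss X :
    aeq (tau (msubs ts (MRel a))) (tau (msubs ss (MRel b))) ->
    rule [:: psubs ss (PRel b) ⊢[F] X] (psubs ts (PRel a) ⊢[F] X)
| r_atom_eq F r1 r2 r3 r4 ts ss X :
    aeq (tau (msubs ts (MEq r1 r2))) (tau (msubs ss (MEq r3 r4))) ->
    rule [:: psubs ss (PEq r3 r4) ⊢[F] X] (psubs ts (PEq r1 r2) ⊢[F] X)
(* exchange, weakening and contraction *)
| r_exch_l F X Y Z : rule [:: PAnd Y X ⊢[F] Z] (PAnd X Y ⊢[F] Z)
| r_exch_r F X Y Z : rule [:: Z ⊢[F] SOr X Y] (Z ⊢[F] SOr Y X)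
| r_weak_l F X Y Z : rule [:: Y ⊢[F] Z] (PAnd X Y ⊢[F] Z)
| r_weak_r F X Y Z : rule [:: Z ⊢[F] Y] (Z ⊢[F] SOr Y X)
| r_contr_l F X Y : rule [:: PAnd X X ⊢[F] Y] (X ⊢[F] Y)
| r_contr_r F X Y : rule [:: Y ⊢[F] SOr X X] (Y ⊢[F] X)
(* equality *)
| r_eq_refl F t X Y : rule [:: PAnd (PEq t t) X ⊢[F] Y] (X ⊢[F] Y)
| r_eq_subst F t s y r xs ys zs X :
    y \notin domf r ->
    perm_eq xs (fv_fam r `\` (fv_term t `|` fv_term s)) ->
    perm_eq ys (fv_term s `\` (fv_term t `|` fv_fam r)) ->
    perm_eq zs (fv_term t `\` (fv_term s `|` fv_fam r)) ->
    rule [:: pcyls xs (PEq t s) ⊢[F] scyls ys (SSub r.[y <- t] X)]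
         (pcyls xs (PEq t s) ⊢[F] scyls zs (SSub r.[y <- s] X))
(* introduction rules *)
| r_rel_l F R a X : rule [:: PRel a ⊢[F] X] (PForm (@MRel R a) ⊢[F] X)
| r_eq_l F s t X : rule [:: PEq s t ⊢[F] X] (PForm (MEq s t) ⊢[F] X)
| r_bot_l F : rule [::] (PForm (MBot F) ⊢[F] SBot F)
| r_bot_r F X : rule [:: X ⊢[F] SBot F] (X ⊢[F] SForm (MBot F))
| r_top_l F X : rule [:: PTop F ⊢[F] X] (PForm (MTop F) ⊢[F] X)
| r_top_r F : rule [::] (PTop F ⊢[F] SForm (MTop F))
| r_and_l F A B X :
    rule [:: PAnd (PForm A) (PForm B) ⊢[F] X] (PForm (MAnd A B) ⊢[F] X)
| r_and_r F A B X Y :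
    rule [:: X ⊢[F] SForm A; Y ⊢[F] SForm B]
         (PAnd X Y ⊢[F] SForm (MAnd A B))
| r_or_l F A B X Y :
    rule [:: PForm A ⊢[F] X; PForm B ⊢[F] Y]
         (PForm (MOr A B) ⊢[F] SOr X Y)
| r_or_r F A B X :
    rule [:: X ⊢[F] SOr (SForm A) (SForm B)] (X ⊢[F] SForm (MOr A B))
| r_imp_l F A B X Y :
    rule [:: X ⊢[F] SForm A; PForm B ⊢[F] Y]
         (PForm (MImp A B) ⊢[F] SImp X Y)
| r_imp_r F A B X :
    rule [:: X ⊢[F] SImp (PForm A) (SForm B)] (X ⊢[F] SForm (MImp A B))
| r_ex_l F x A X :
    rule [:: PEx x (PForm A) ⊢[F] X] (PForm (MEx x A) ⊢[F] X)
| r_ex_r F x A X :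
    rule [:: X ⊢[x |` F] SForm A] (PEx x X ⊢[F `\ x] SForm (MEx x A))
| r_all_l F x A X :
    rule [:: PForm A ⊢[x |` F] X] (PForm (MAll x A) ⊢[F `\ x] SAll x X)
| r_all_r F x A X :
    rule [:: X ⊢[F] SAll x (SForm A)] (X ⊢[F] SForm (MAll x A))
| r_cyl_l F x A X :
    rule [:: PCyl x (PForm A) ⊢[F] X] (PForm (MCyl x A) ⊢[F] X)
| r_cyl_r F x A X :
    rule [:: X ⊢[F] SCyl x (SForm A)] (X ⊢[F] SForm (MCyl x A))
| r_sub_l F t A X :
    rule [:: PSub t (PForm A) ⊢[F] X] (PForm (MSub t A) ⊢[F] X)
| r_sub_r F t A X :
    rule [:: X ⊢[F] SSub t (SForm A)] (X ⊢[F] SForm (MSub t A))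
(* Grishin rules *)
| r_grishin_l F X Y Z W :
    rule [:: PSucc X (PAnd Y Z) ⊢[F] W] (PAnd (PSucc X Y) Z ⊢[F] W)
| r_grishin_r F X Y Z W :
    rule [:: W ⊢[F] SImp X (SOr Y Z)] (W ⊢[F] SOr (SImp X Y) Z)
(* monotonicity of substitution *)
| r_sub_mono t X Y :
    rule [:: X ⊢[domf t] Y] (PSub t X ⊢[fv_fam t] SSub t Y).

(* Every sequent occurring in a derivation is well typed. *)
Inductive derivable : sequent -> Prop :=
| derive ps c : rule ps c -> sq_typed c ->
    (forall p, List.In p ps -> derivable p) -> derivable c.

End Language.

Arguments FTop {L}.
Arguments FBot {L}.
Arguments TVar {L} v.
Arguments TCst {L} c.
Arguments MTop {L} F.
Arguments MBot {L} F.
Arguments PTop {L} F.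
Arguments SBot {L} F.

Notation "X ⊢[ F ] Y" := (Sequent F X Y)
  (at level 70, F at level 200, no associativity).

(* Main.v *)
(** A valuation of all the variables in a first-order structure interprets
    every formula and structural connective of D.FO: cylindrifications become
    identities, substitutions become precomposition, and their adjoints quantify
    over preimages.  Every rule then preserves validity, the types entering only
    through the fact that the truth of a structure of type [F] depends on the
    values of the variables in [F].  As [tau (kappa F A)] is literally [A], a
    derivation makes [A] valid in all models, and the Hilbert system is complete:
    the finitely many symbols of [A] leave countably many formulas, so a Henkin
    construction can use the variables themselves as witnesses. *)
Require Import Defs.
From mathcomp Require Import all_boot.
From mathcomp Require Import finmap.
From Stdlib Require Import Classical ClassicalEpsilon.
From Stdlib Require Import FunctionalExtensionality PropExtensionality.
From Stdlib Require List.

Set Implicit Arguments.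
Unset Strict Implicit.
Unset Printing Implicit Defensive.

Local Open Scope fset_scope.
Local Open Scope fmap_scope.

(** * Fresh variables, capture avoidance and the translation of [kappa] *)

Section Syntax.

Variable L : signature.
Implicit Types (s t : term L) (r : Defs.family L) (A B C : form L).

(** Terms nest inside finite functions; this principle supplies an induction hypothesis for each
    argument of a function symbol. *)
Lemma term_nested_ind (P : term L -> Prop) :
  (forall v, P (TVar v)) -> (forall c, P (TCst c)) ->
  (forall f (a : {ffun 'I_(fun_ar f) -> term L}),
     (forall i, P (a i)) -> P (TFun a)) ->
  forall t, P t.
Proof.
move=> Pv Pc Pf; fix IH 1; case=> [v|c|f a]; first exact: Pv.
  exact: Pc.
by apply: Pf => i; apply: IH.
Qed.

(** The expression used by [rebind] to avoid capture, so that [fresh_notin] applies there; it also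
    provides the Henkin witnesses. *)
Definition fresh (V : {fset var}) : var := (\max_(w <- V) w).+1.

Lemma fresh_notin V : fresh V \notin V.
Proof.
apply/negP => H; have := leq_bigmax_seq (P := xpredT) (F := id) (fresh V) H isT.
by rewrite /fresh ltnn.
Qed.

Lemma fv_args_sub n (a : {ffun 'I_n -> term L}) i :
  fv_term (a i) `<=` fv_args a.
Proof. by apply: bigfcup_sup; rewrite // mem_index_enum. Qed.

Lemma fv_fam_sub r v (vr : v \in domf r) :
  fv_term (subst_var r v) `<=` fv_fam r.
Proof.
rewrite /subst_var in_fnd /=.
by apply: (bigfcup_sup (fun v : domf r => fv_term (r v)));
  rewrite // mem_index_enum.
Qed.

Lemma subst_var_set r x s v :
  subst_var r.[x <- s] v = if v == x then s else subst_var r v.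
Proof. by rewrite /subst_var fnd_set; case: eqP. Qed.

(** Capture avoidance: either [x] already avoids all the substituted terms, or it is replaced by a
    variable larger than all of theirs. *)
Lemma rebind_notin r x (V : {fset var}) v :
  v \in V -> rebind r x V \notin fv_term (subst_var r v).
Proof.
move=> vV; rewrite /rebind; set W := \bigcup_(_ <- _) _.
have /fsubsetP sW : fv_term (subst_var r v) `<=` W by apply: bigfcup_sup.
case: ifPn => [_|xW]; last by apply: contra xW; apply: sW.
by apply: contra (fresh_notin W); apply: sW.
Qed.

Lemma subst_term_fresh s x t :
  x \notin fv_term t -> subst_term [fmap].[x <- s] t = t.
Proof.
elim/term_nested_ind: t => //= [v|f a IH].
  by rewrite inE subst_var_set eq_sym => /negPf ->; rewrite /subst_var fnd_fmap0.
move=> xa; congr TFun; apply/ffunP => i; rewrite ffunE; apply: IH.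
by apply: contra xa; apply/fsubsetP/(fv_args_sub a).
Qed.

(** The measure for the truth lemma: an instance of a quantified formula is not a subformula, but
    substitution preserves this size. *)
Fixpoint form_size A : nat :=
  match A with
  | FAnd A B | FOr A B | FImp A B => (form_size A + form_size B).+1
  | FAll _ A | FEx _ A => (form_size A).+1
  | _ => 0
  end.

Lemma form_size_subst r A : form_size (subst r A) = form_size A.
Proof.
elim: A r => //= [A IA B IB|A IA B IB|A IA B IB|x A IA|x A IA] r;
  by rewrite ?IA ?IB.
Qed.

(** [kappa] only adds cylindrifications and type annotations, and [tau] erases both, so the equality
    is literal and not merely up to renaming. *)
Lemma tau_kappa F A : tau (kappa F A) = A.
Proof.
have pad G (B : mtform L) : tau (mt_pad G B) = tau B.
  by rewrite /mt_pad; elim: (sort _ _).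
elim: A F => [R a|s t|||A IA B IB|A IA B IB|A IA B IB|x A IA|x A IA] F //=;
  rewrite ?pad ?IA ?IB //; by case: ifP => _ /=; rewrite IA.
Qed.

End Syntax.

(** * First-order models, satisfaction and the substitution lemma *)

Section Semantics.

Variable L : signature.

Record model := Model {
  dom : Type;
  rel_i : forall R : rel_sym L, {ffun 'I_(rel_ar R) -> dom} -> Prop;
  fun_i : forall f : fun_sym L, {ffun 'I_(fun_ar f) -> dom} -> dom;
  cst_i : cst_sym L -> dom
}.

Variable M : model.
Implicit Types (s t : term L) (r : Defs.family L) (A B C : form L).
Implicit Types (e : var -> dom M) (d : dom M).

Definition upd e x d : var -> dom M := fun v => if v == x then d else e v.

Fixpoint eval e t : dom M :=
  match t with
  | TVar v => e v
  | TCst c => cst_i M c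
  | TFun f a => fun_i [ffun i => eval e (a i)]
  end.

Definition eval_fam e r : var -> dom M := fun v => eval e (subst_var r v).

Fixpoint sat e A : Prop :=
  match A with
  | FRel R a => rel_i [ffun i => eval e (a i)]
  | FEq s t => eval e s = eval e t
  | FTop => True
  | FBot => False
  | FAnd A B => sat e A /\ sat e B
  | FOr A B => sat e A \/ sat e B
  | FImp A B => sat e A -> sat e B
  | FAll x A => forall d, sat (upd e x d) A
  | FEx x A => exists d, sat (upd e x d) A
  end.

Definition agree (F : {fset var}) e e' := forall v, v \in F -> e v = e' v.

Lemma agree_sym F e e' : agree F e e' -> agree F e' e.
Proof. by move=> H v /H. Qed.

Lemma agree_sub F G e e' : F `<=` G -> agree G e e' -> agree F e e'.
Proof. by move=> /fsubsetP FG H v /FG /H. Qed.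

Lemma agree_upd F e e' x d :
  agree (F `\ x) e e' -> agree F (upd e x d) (upd e' x d).
Proof.
by move=> H v vF; rewrite /upd; case: eqP => // /eqP vx; apply: H; rewrite !inE vx.
Qed.

Lemma agree_upd_notin F e x d : x \notin F -> agree F (upd e x d) e.
Proof. by move=> xF v vF; rewrite /upd; case: eqP => // vx; rewrite vx (negPf xF) in vF. Qed.

Lemma upd_id e x : upd e x (e x) = e.
Proof. by apply: functional_extensionality => v; rewrite /upd; case: eqP => // ->. Qed.

Lemma eval_agree e e' t : agree (fv_term t) e e' -> eval e t = eval e' t.
Proof.
elim/term_nested_ind: t => //= [v|f a IH] H; first by apply: H; rewrite inE.
congr fun_i; apply/ffunP => i; rewrite !ffunE; apply: IH.
exact: agree_sub (fv_args_sub a i) H.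
Qed.

Lemma eval_subst e r t : eval e (subst_term r t) = eval (eval_fam e r) t.
Proof.
elim/term_nested_ind: t => //= f a IH.
by congr fun_i; apply/ffunP => i; rewrite !ffunE.
Qed.

Lemma eval_fam_agree e e' r :
  agree (fv_fam r) e e' -> agree (domf r) (eval_fam e r) (eval_fam e' r).
Proof. by move=> H v vr; apply: eval_agree; apply: agree_sub (fv_fam_sub vr) H. Qed.

Lemma eval_fam_set e r x t :
  eval_fam e r.[x <- t] = upd (eval_fam e r) x (eval e t).
Proof.
by apply: functional_extensionality => v; rewrite /eval_fam subst_var_set /upd; case: eqP.
Qed.

(** Agreement is claimed only on [domf r']: elsewhere the composed family leaves variables alone,
    while the right-hand side still applies [r]. *)
Lemma eval_fam_subst e r r' :
  agree (domf r') (eval_fam e (subst_fam r r')) (eval_fam (eval_fam e r) r').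
Proof.
move=> v vr; rewrite /eval_fam /subst_var (in_fnd vr).
rewrite (in_fnd (vr : v \in domf (subst_fam r r'))) /= ffunE eval_subst.
by [].
Qed.

Lemma sat_agree_imp e e' A : agree (fv A) e e' -> sat e A -> sat e' A.
Proof.
elim: A e e' => [R a|s t|||A IA B IB|A IA B IB|A IA B IB|x A IA|x A IA] e e' H //=.
- rewrite (_ : [ffun i => eval e (a i)] = [ffun i => eval e' (a i)]) //.
  apply/ffunP => i; rewrite !ffunE; apply: eval_agree.
  exact: agree_sub (fv_args_sub a i) H.
- rewrite (eval_agree (e' := e') (t := s)) ?(eval_agree (e' := e') (t := t)) //;
  by apply: agree_sub H; rewrite ?fsubsetUl ?fsubsetUr.
1-3: have HA : agree (fv A) e e' by apply: agree_sub H; apply: fsubsetUl.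
1-3: have HB : agree (fv B) e e' by apply: agree_sub H; apply: fsubsetUr.
- by case=> /(IA _ _ HA) ? /(IB _ _ HB).
- by case=> [/(IA _ _ HA)|/(IB _ _ HB)]; [left|right].
- by move=> sAB /(IA _ _ (agree_sym HA)) /sAB /(IB _ _ HB).
- by move=> sA d; apply: IA (sA d); apply: agree_upd.
- by case=> d sA; exists d; apply: IA sA; apply: agree_upd.
Qed.

Lemma sat_agree e e' A : agree (fv A) e e' -> sat e A <-> sat e' A.
Proof. by move=> H; split; apply: sat_agree_imp => //; apply: agree_sym. Qed.

Lemma sat_subst e r A : sat e (subst r A) <-> sat (eval_fam e r) A.
Proof.
(* The quantifier cases: by [rebind_notin] the new bound variable [z] does not occur in the terms
   substituted for the other free variables, so updating [z] before the substitution amounts to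
   updating [x] after it. *)
have bind e0 r0 x B d : let z := rebind r0 x (fv B `\ x) in
    agree (fv B) (eval_fam (upd e0 z d) r0.[x <- TVar z])
                 (upd (eval_fam e0 r0) x d).
  move=> z; rewrite eval_fam_set /= /upd eqxx; apply: agree_upd => v vB.
  by apply: eval_agree; apply: agree_upd_notin; apply: rebind_notin.
elim: A e r => [R a|s t|||A IA B IB|A IA B IB|A IA B IB|x A IA|x A IA] e r //=;
  rewrite ?IA ?IB //.
- rewrite (_ : [ffun i => eval e _] = [ffun i => eval (eval_fam e r) (a i)]) //.
  by apply/ffunP => i; rewrite !ffunE eval_subst.
- by rewrite !eval_subst.
- by split=> H d; move: (H d); rewrite IA; apply: sat_agree_imp;
    [|apply: agree_sym]; apply: bind.
- by split=> -[d H]; exists d; move: H; rewrite IA; apply: sat_agree_imp;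
    [|apply: agree_sym]; apply: bind.
Qed.

Lemma eval_fam0 e : eval_fam e [fmap] = e.
Proof. by apply: functional_extensionality => v; rewrite /eval_fam /subst_var fnd_fmap0. Qed.

Lemma sat_subst1 e A t x : sat e (subst1 A t x) <-> sat (upd e x (eval e t)) A.
Proof. by rewrite /subst1 sat_subst eval_fam_set eval_fam0. Qed.

Lemma sat_rename e A x y d : y \notin fv A ->
  sat (upd e y d) (subst1 A (TVar y) x) <-> sat (upd e x d) A.
Proof.
move=> yA; rewrite sat_subst1 /=.
have -> : upd e y d y = d by rewrite /upd eqxx.
apply: sat_agree.
apply: agree_upd => v; rewrite !inE => /andP[_ vA].
by apply: (agree_upd_notin (F := fv A)).
Qed.

Lemma sat_aeq A B : aeq A B -> forall e, sat e A <-> sat e B.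
Proof.
elim=> {A B} //=.
- by move=> A B _ IA e; rewrite IA.
- by move=> A B C _ IA _ IB e; rewrite IA.
- by move=> A A' B B' _ IA _ IB e; rewrite IA IB.
- by move=> A A' B B' _ IA _ IB e; rewrite IA IB.
- by move=> A A' B B' _ IA _ IB e; rewrite IA IB.
- by move=> x A A' _ IA e; split=> H d; apply/IA.
- by move=> x A A' _ IA e; split=> -[d] /IA H; exists d.
- by move=> x y A yA e; split=> H d; move: (H d); rewrite sat_rename.
- by move=> x y A yA e; split=> -[d H]; exists d; move: H; rewrite sat_rename.
Qed.

(** * Soundness of the display calculus *)

(** The residuals of disjunction are read classically, as a conjunction with a negation. The
    adjoints of a substitution quantify over the assignments whose image under it agrees with [e] on
    its domain. *)
Fixpoint psat (X : pstr L) e : Prop :=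
  match X with
  | PForm A => sat e (tau A)
  | PTop _ => True
  | PRel R a => rel_i [ffun i => eval e (a i)]
  | PEq s t => eval e s = eval e t
  | PAnd X X' => psat X e /\ psat X' e
  | PSucc Y X => ~ ssat Y e /\ psat X e
  | PPrec X Y => psat X e /\ ~ ssat Y e
  | PEx x X => exists d, psat X (upd e x d)
  | PCyl _ X => psat X e
  | PSub r X => psat X (eval_fam e r)
  | PExSub r X => exists2 e', agree (domf r) (eval_fam e' r) e & psat X e'
  end
with ssat (Y : sstr L) e : Prop :=
  match Y with
  | SForm A => sat e (tau A)
  | SBot _ => False
  | SOr Y Y' => ssat Y e \/ ssat Y' e
  | SImp X Y => psat X e -> ssat Y e
  | SPmi Y X => psat X e -> ssat Y e
  | SAll x Y => forall d, ssat Y (upd e x d)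
  | SCyl _ Y => ssat Y e
  | SSub r Y => ssat Y (eval_fam e r)
  | SAllSub r Y => forall e', agree (domf r) (eval_fam e' r) e -> ssat Y e'
  end.

Lemma tau_agree F (A : mtform L) : mt_typed F A ->
  forall e e', agree F e e' -> sat e (tau A) <-> sat e' (tau A).
Proof.
elim=> {F A} /=.
- by move=> R a e e' H; apply: (@sat_agree _ _ (FRel a)).
- by move=> s t e e' H; apply: (@sat_agree _ _ (FEq s t)).
- by [].
- by [].
- by move=> F A B _ IA _ IB e e' H; rewrite (IA _ _ H) (IB _ _ H).
- by move=> F A B _ IA _ IB e e' H; rewrite (IA _ _ H) (IB _ _ H).
- by move=> F A B _ IA _ IB e e' H; rewrite (IA _ _ H) (IB _ _ H).
- move=> F y A yF _ IA e e' H; split=> HA d; move: (HA d); apply IA; apply: agree_upd;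
    rewrite fsetU1K //; exact: agree_sym.
- move=> F y A yF _ IA e e' H; split=> -[d HA]; exists d; move: HA; apply IA; apply: agree_upd;
    rewrite fsetU1K //; exact: agree_sym.
- by move=> F x A _ _ IA e e' H; apply: IA; apply: agree_sub H; apply: fsubD1set.
- by move=> r A _ IA e e' H; rewrite !sat_subst; apply: IA; apply: eval_fam_agree.
Qed.

Scheme p_typed_mut := Induction for p_typed Sort Prop
  with s_typed_mut := Induction for s_typed Sort Prop.
Combined Scheme typed_mutind from p_typed_mut, s_typed_mut.

(** This is how types enter soundness: a structure may be moved between assignments that agree on
    its type. The induction is mutual because residuals and implications mix both kinds of
    structures. *)
Lemma str_agree :
  (forall F (X : pstr L), p_typed F X ->
     forall e e', agree F e e' -> psat X e <-> psat X e') /\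
  (forall F (Y : sstr L), s_typed F Y ->
     forall e e', agree F e e' -> ssat Y e <-> ssat Y e').
Proof.
have updU F x e e' d : agree (F `\ x) e e' -> agree (x |` F) (upd e x d) (upd e' x d).
  by move=> H; apply: agree_upd; apply: agree_sub H; apply/fsubsetP=> v;
     rewrite !inE; case: eqP.
have cylU F x e e' : agree (x |` F) e e' -> agree (F `\ x) e e'.
  by apply: agree_sub; apply/fsubsetP=> v; rewrite !inE => /andP[_ ->]; rewrite orbT.
have extR r e e' e0 : agree (domf r) e e' ->
    agree (domf r) (eval_fam e0 r) e -> agree (domf r) (eval_fam e0 r) e'.
  by move=> H H0 v vr; rewrite H0 // H.
(* Agreement is symmetric, so one implication suffices in the quantifier cases. *)
have both F (P : (var -> dom M) -> Prop) :
    (forall e e', agree F e e' -> P e -> P e') ->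
    forall e e', agree F e e' -> P e <-> P e'.
  by move=> H e e' He; split; apply: H => //; apply: agree_sym.
apply: (@typed_mutind L
  (fun F X _ => forall e e', agree F e e' -> psat X e <-> psat X e')
  (fun F Y _ => forall e e', agree F e e' -> ssat Y e <-> ssat Y e')) => //=.
- by move=> F A /tau_agree.
- by move=> R a e e' H; apply: (@sat_agree _ _ (FRel a)).
- by move=> s t e e' H; apply: (@sat_agree _ _ (FEq s t)).
- by move=> F X X' _ I _ I' e e' H; rewrite (I _ _ H) (I' _ _ H).
- by move=> F X X' _ I _ I' e e' H; rewrite (I _ _ H) (I' _ _ H).
- by move=> F X X' _ I _ I' e e' H; rewrite (I _ _ H) (I' _ _ H).
- move=> F x X _ I; apply: both => e e' H [d Hd]; exists d; move: Hd.
  by apply I; apply: updU; apply: agree_sym.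
- by move=> F x X _ I e e' /cylU; apply: I.
- by move=> r X _ I e e' /eval_fam_agree; apply: I.
- move=> r X _ I; apply: both => e e' H [e0 H0 HX]; exists e0 => //.
  exact: extR H0.
- by move=> F A /tau_agree.
- by move=> F X X' _ I _ I' e e' H; rewrite (I _ _ H) (I' _ _ H).
- by move=> F X X' _ I _ I' e e' H; rewrite (I _ _ H) (I' _ _ H).
- by move=> F X X' _ I _ I' e e' H; rewrite (I _ _ H) (I' _ _ H).
- move=> F x X _ I; apply: both => e e' H Hd d; move: (Hd d).
  by apply I; apply: updU; apply: agree_sym.
- by move=> F x X _ I e e' /cylU; apply: I.
- by move=> r X _ I e e' /eval_fam_agree; apply: I.
- move=> r X _ I; apply: both => e e' H HX e0 H0; apply: HX.
  by apply: extR H0; apply: agree_sym.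
Qed.

Definition psat_agree F X tX e e' H := @proj1 _ _ str_agree F X tX e e' H.
Definition ssat_agree F Y tY e e' H := @proj2 _ _ str_agree F Y tY e e' H.

(** Assignments range over all variables whatever the type of the sequent, so premises and
    conclusions of different types are tested on the same assignments. *)
Definition valid (S : sequent L) : Prop :=
  forall e, psat (sq_left S) e -> ssat (sq_right S) e.


Lemma psat_pcyls xs (X : pstr L) e : psat (pcyls xs X) e = psat X e.
Proof. by elim: xs. Qed.

Lemma ssat_scyls xs (Y : sstr L) e : ssat (scyls xs Y) e = ssat Y e.
Proof. by elim: xs. Qed.

(** Serves the rules for atoms with a common translation: a stack of structural substitutions has
    the truth value of the translated formula. *)
Lemma psat_psubs rs (A : mtform L) X e :
  (forall e', sat e' (tau A) <-> psat X e') ->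
  sat e (tau (msubs rs A)) <-> psat (psubs rs X) e.
Proof. by move=> AX; elim: rs e => //= r rs IH e; rewrite sat_subst. Qed.

(** The semantic content of moving a quantifier across a substitution: since [z] is absent from the
    terms of [r], updating it changes only the value sent to [y]. *)
Lemma eval_fam_bind F e r y z d :
  F `\ y = domf r -> z \notin fv_fam r ->
  agree (y |` F) (upd (eval_fam e r) y d)
    (eval_fam (upd e z d) r.[y <- TVar z]).
Proof.
move=> Fr zr; rewrite eval_fam_set /=.
have -> : upd e z d z = d by rewrite /upd eqxx.
apply: agree_upd; apply: (@agree_sub _ (domf r)).
  by rewrite -Fr; apply/fsubsetP=> v; rewrite !inE; case: eqP.
by apply: eval_fam_agree; apply: agree_sym; apply: agree_upd_notin.
Qed.

(** A structure under a cylindrification of [y] has a type without [y], so the term sent to [y] is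
    never read. *)
Lemma eval_fam_cyl F e r y s :
  F `\ y = domf r -> y \notin domf r ->
  agree (F `\ y) (eval_fam e r.[y <- s]) (eval_fam e r).
Proof. by move=> -> yr; rewrite eval_fam_set; apply: agree_upd_notin. Qed.

(** The typing rule concludes with a computed set, from which its parameter cannot be recovered;
    inversion therefore yields some [G] and an equation. *)
Lemma p_typed_ex F y (X : pstr L) :
  p_typed F (PEx y X) -> exists2 G, F = G `\ y & p_typed (y |` G) X.
Proof. by move=> H; inversion H; subst; exists F0. Qed.

Lemma s_typed_all F y (Y : sstr L) :
  s_typed F (SAll y Y) -> exists2 G, F = G `\ y & s_typed (y |` G) Y.
Proof. by move=> H; inversion H; subst; exists F0. Qed.

Lemma p_typed_cyl F y (X : pstr L) :
  p_typed F (PCyl y X) -> exists2 G, F = y |` G & p_typed (G `\ y) X.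
Proof. by move=> H; inversion H; subst; exists F0. Qed.

Lemma s_typed_cyl F y (Y : sstr L) :
  s_typed F (SCyl y Y) -> exists2 G, F = y |` G & s_typed (G `\ y) Y.
Proof. by move=> H; inversion H; subst; exists F0. Qed.

Lemma p_typed_sub F r (X : pstr L) : p_typed F (PSub r X) -> p_typed (domf r) X.
Proof. by move=> H; inversion H. Qed.

Lemma s_typed_sub F r (Y : sstr L) : s_typed F (SSub r Y) -> s_typed (domf r) Y.
Proof. by move=> H; inversion H. Qed.

Lemma birule_valid p c : birule p c -> sq_typed p -> sq_typed c ->
  valid p <-> valid c.
Proof.
have notinD (F : {fset var}) x : x \notin F `\ x by rewrite !inE eqxx.
have domD (G : {fset var}) (t : Defs.family L) (s : term L) y :
    domf t.[y <- s] = y |` G -> y \notin domf t -> G `\ y = domf t.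
  move=> /fsetP H yt; apply/fsetP=> v; move: (H v); rewrite dom_setf !inE.
  by case: eqP => [->|] //=; rewrite (negPf yt).
case=> {p c}.
- move=> F X Y Z _ _; split=> H e /=; [move=> ? ?|case=> ? /H]; last by auto.
  by apply: H.
- move=> F X Y Z _ _; split=> H e /=; [move=> ? ?|case=> /H]; last by auto.
  by apply: H.
- move=> F X Y Z _ _; split=> H e /=; first by case=> ? /H; case.
  (* Moving a disjunct back from the antecedent needs excluded middle. *)
  by move=> HZ; case: (classic (ssat X e)) => HX; [left|right; apply: H].
- move=> F X Y Z _ _; split=> H e /=; first by case=> /H; case.
  by move=> HZ; case: (classic (ssat Y e)) => HX; [right|left; apply: H].
- move=> F x X Y _ [_ /= tY].
  (* The type of [Y] omits [x], so updates at [x] do not affect it; in the converse direction the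
     current value [e x] is the witness. *)
  have E e d := ssat_agree tY (agree_upd_notin e d (notinD F x)).
  split=> H e /=; first by case=> d /H /= /E.
  by move=> HX; apply: H; exists (e x); rewrite upd_id.
- move=> F x X Y _ [/= tY _].
  have E e d := psat_agree tY (agree_upd_notin e d (notinD F x)).
  split=> H e /=; first by move=> HX d; apply: H => /=; apply/E.
  by move=> /H /= /(_ (e x)); rewrite upd_id.
(* An assignment in the preimage of [e] has an image agreeing with [e] on [domf t], the type of [X];
   conversely [e] lies in the preimage of [eval_fam e t]. *)
- move=> t X Y _ [_ /= tX]; split=> H e /=.
    by case=> e' He /H /= HX; apply/(ssat_agree tX (agree_sym He)).
  by move=> HY; apply: H => /=; exists e.
- move=> t X Y _ [/= tX _]; split=> H e /=.
    by move=> HX e' He; apply: H => /=; apply/(psat_agree tX He).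
  by move=> /H; apply.
- by [].
- by [].
- by [].
- by [].
- move=> F X Y _ _; split=> H e /=; first by case=> _ /H.
  by move=> ?; apply: H.
- move=> F X Y _ _; split=> H e /=; first by move=> /H; left.
  by move=> /H; case.
- by move=> F X Y Z W _ _; split=> H e /= ?; apply: H => /=; tauto.
- by move=> F X Y Z W _ _; split=> H e /H /= ?; tauto.
- by [].
(* A tilde operator is an identity or a precomposition, and commutes with the pointwise connectives
   by computation. *)
- by move=> F [x|t].
- by move=> F [x|t].
- by move=> F [x|t].
- by move=> F [x|t].
- by move=> F [x|t].
- by move=> F [x|t].
- by [].
- by [].
- by [].
- by [].
- move=> F t y z X Y _; rewrite inE negb_or => /andP[zt _].
  case=> /= /p_typed_sub /p_typed_ex [G eG tX] _ _.
  have E e d := psat_agree tX (eval_fam_bind e d (esym eG) zt).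
  split=> H e /= [d] /E HX; apply: H; exists d => //; exact/E.
- move=> F t y z X Y _; rewrite inE negb_or => /andP[zt _].
  case=> /= _ /s_typed_sub /s_typed_all [G eG tX] _.
  have E e d := ssat_agree tX (eval_fam_bind e d (esym eG) zt).
  by split=> H e /H /= HX d; apply/E.
- move=> F t s X Y _ [/= /p_typed_sub /p_typed_sub tX _] _.
  have E e := psat_agree tX (@eval_fam_subst e t s).
  by split=> H e /= /E ?; apply: H.
- move=> F t s X Y _ [/= _ /s_typed_sub /s_typed_sub tX] _.
  have E e := ssat_agree tX (@eval_fam_subst e t s).
  by split=> H e /H /= /E.
- move=> F t s y zs X Y yt _ [/= /p_typed_sub /p_typed_cyl [G eG tX] _] _.
  have E e := psat_agree tX (@eval_fam_cyl G e t y s (domD _ _ _ _ eG yt) yt).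
  split=> H e /= HX; apply: H => /=; first by apply/E; rewrite psat_pcyls in HX.
  by rewrite psat_pcyls; apply/E.
- move=> F t s y zs X Y yt _ [/= _ /s_typed_sub /s_typed_cyl [G eG tX]] _.
  have E e := ssat_agree tX (@eval_fam_cyl G e t y s (domD _ _ _ _ eG yt) yt).
  split=> H e /H /=; first by rewrite ssat_scyls /= => /E.
  by rewrite ssat_scyls /= => /E.
Qed.

Lemma rule_valid ps c : rule ps c -> sq_typed c ->
  (forall p, List.In p ps -> sq_typed p /\ valid p) -> valid c.
Proof.
have one p : (forall q, List.In q [:: p] -> sq_typed q /\ valid q) ->
    sq_typed p /\ valid p by apply; left.
have two p p' : (forall q, List.In q [:: p; p'] -> sq_typed q /\ valid q) ->
    valid p /\ valid p'.
  by move=> H; split; apply: (proj2 (H _ _)); rewrite /=; tauto.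
case=> {ps c}.
- by move=> p c b tc /one [tp] H; apply/(birule_valid b tp tc).
- by move=> p c b tc /one [tp] H; apply/(birule_valid b tc tp).
- by move=> F R a _ _ e.
- by move=> F s t _ _ e.
- by move=> F X A Y _ /two [H H'] e /H /H'.
- by move=> F x X Y _ /one [_ H] e HX; apply: H => /=; exists (e x); rewrite upd_id.
- by move=> F t X Y _ /one [_ H] e HX; apply: H => /=; exists e.
- move=> F R a b ts ss X /sat_aeq ab _ /one [_ H] e /= Ha; apply: H => /=; move: Ha.
  rewrite -(@psat_psubs ts (MRel a)) // -(@psat_psubs ss (MRel b)) //.
  by move=> /ab.
- move=> F r1 r2 r3 r4 ts ss X /sat_aeq ab _ /one [_ H] e /= Ha; apply: H => /=; move: Ha.
  rewrite -(@psat_psubs ts (MEq r1 r2)) // -(@psat_psubs ss (MEq r3 r4)) //.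
  by move=> /ab.
- by move=> F X Y Z _ /one [_ H] e /= [? ?]; apply: H.
- by move=> F X Y Z _ /one [_ H] e /= /H [|]; auto.
- by move=> F X Y Z _ /one [_ H] e /= [_ /H].
- by move=> F X Y Z _ /one [_ H] e /= /H; left.
- by move=> F X Y _ /one [_ H] e /= ?; apply: H.
- by move=> F X Y _ /one [_ H] e /= /H [].
- by move=> F t X Y _ /one [_ H] e /= ?; apply: H.
- move=> F t s y r xs ys zs X yr _ _ _ _ /one [_ H] e /= Hts.
  (* The equation in the antecedent makes both extended families induce the same assignment. *)
  have := H e Hts; rewrite /= !ssat_scyls /= !eval_fam_set.
  by move: Hts; rewrite psat_pcyls /= => ->.
- by move=> F R a X _ /one [_ H].
- by move=> F s t X _ /one [_ H].
- by move=> F _ _ e.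
- by move=> F X _ /one [_ H].
- by move=> F X _ /one [_ H] e _; apply: H.
- by move=> F _ _ e.
- by move=> F A B X _ /one [_ H].
- by move=> F A B X Y _ /two [H H'] e /= [/H ? /H' ?].
- by move=> F A B X Y _ /two [H H'] e /= [/H|/H']; auto.
- by move=> F A B X _ /one [_ H].
- by move=> F A B X Y _ /two [H H'] e /= AB /H /AB /H'.
- by move=> F A B X _ /one [_ H].
- by move=> F x A X _ /one [_ H].
- by move=> F x A X _ /one [_ H] e /= [d /H HA]; exists d.
- by move=> F x A X _ /one [_ H] e /= HA d; apply: H.
- by move=> F x A X _ /one [_ H].
- by move=> F x A X _ /one [_ H].
- by move=> F x A X _ /one [_ H].
- by move=> F t A X _ /one [_ H] e /= /sat_subst; apply: H.
- by move=> F t A X _ /one [_ H] e /= /H /= ?; apply/sat_subst.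
- by move=> F X Y Z W _ /one [_ H] e /= ?; apply: H => /=; tauto.
- move=> F X Y Z W _ /one [_ H] e /= /H /= ?.
  by case: (classic (psat X e)); tauto.
- by move=> t X Y _ /one [_ H] e /= /H.
Qed.

Lemma derivable_valid S : derivable S -> valid S.
Proof.
elim=> ps c r tc dps IH; apply: (rule_valid r tc) => p pp; split; last exact: IH.
by case: (dps p pp).
Qed.
End Semantics.

(** * Completeness of the Hilbert system *)

Section Completeness.

Variable L : signature.
Implicit Types (s t : term L) (r : Defs.family L) (A B C : form L).

(** Generalization is admissible because the axioms are closed under universal prefixes and
    [ax_dist] carries the quantifier through modus ponens. *)
Lemma fo_provable_gen x A : fo_provable A -> fo_provable (FAll x A).
Proof.
elim=> {A} [A ax|A B _ IAB _ IA|A B AB _ IA].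
- by apply: fo_ax; apply: ax_gen.
- by apply: fo_mp IA; apply: fo_mp IAB; apply: fo_ax; apply: ax_dist.
- by apply: fo_alpha IA; apply: aeq_all.
Qed.

Lemma fo_taut A : tautology A -> fo_provable A.
Proof. by move=> tA; apply: fo_ax; apply: ax_taut. Qed.

Lemma fo_taut1 A B : tautology (FImp A B) -> fo_provable A -> fo_provable B.
Proof. by move=> /fo_taut; apply: fo_mp. Qed.

Lemma fo_taut2 A B C : tautology (FImp A (FImp B C)) ->
  fo_provable A -> fo_provable B -> fo_provable C.
Proof. by move=> tA /(fo_taut1 tA); apply: fo_mp. Qed.

Ltac taut :=
  let val := fresh "val" in move=> val /=;
  repeat match goal with
  | |- context [prop_eval val ?A] => case: (prop_eval val A)
  | |- context [val ?A] => case: (val A)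
  end; done.

(** * The countable fragment over finitely many symbols *)

Definition symbol : Type := (rel_sym L + fun_sym L + cst_sym L)%type.
Implicit Type S : seq symbol.

Fixpoint term_over S t : Prop :=
  match t with
  | TVar _ => True
  | TCst c => List.In (inr c) S
  | TFun f a => List.In (inl (inr f)) S /\ forall i, term_over S (a i)
  end.

Fixpoint form_over S A : Prop :=
  match A with
  | FRel R a => List.In (inl (inl R)) S /\ forall i, term_over S (a i)
  | FEq s t => term_over S s /\ term_over S t
  | FTop | FBot => True
  | FAnd A B | FOr A B | FImp A B => form_over S A /\ form_over S B
  | FAll _ A | FEx _ A => form_over S A
  end.

Lemma term_over_sub S S' t :
  (forall c, List.In c S -> List.In c S') -> term_over S t -> term_over S' t.
Proof.
move=> SS'; elim/term_nested_ind: t => //= [c|f a IH]; first exact: SS'.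
by case=> fS aS; split=> [|i]; [exact: SS'|exact: IH].
Qed.

Lemma form_over_sub S S' A :
  (forall c, List.In c S -> List.In c S') -> form_over S A -> form_over S' A.
Proof.
move=> SS'; elim: A => //= [R a|s t|A IA B IB|A IA B IB|A IA B IB].
- by case=> RS aS; split=> [|i]; [exact: SS'|exact: term_over_sub (aS i)].
- by case=> sS tS; split; apply: term_over_sub SS' _.
all: by case=> /IA ? /IB ?.
Qed.

Lemma args_over n (a : {ffun 'I_n -> term L}) :
  (forall i, exists S, term_over S (a i)) ->
  exists S, forall i, term_over S (a i).
Proof.
move=> H.
have [g Hg] : exists g : 'I_n -> seq symbol, forall i, term_over (g i) (a i).
  exists (fun i => proj1_sig (constructive_indefinite_description _ (H i))).
  by move=> i; case: constructive_indefinite_description.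
exists (flatten [seq g i | i <- enum 'I_n]) => i.
apply: term_over_sub (Hg i) => c ci.
have: i \in enum 'I_n by rewrite mem_enum.
elim: (enum 'I_n) => //= j l IH; rewrite inE => /orP[/eqP <-|/IH il];
  by apply/List.in_or_app; auto.
Qed.

Lemma term_over_exists t : exists S, term_over S t.
Proof.
elim/term_nested_ind: t => [v|c|f a /args_over [S aS]]; first by exists [::].
  by exists [:: inr c]; left.
exists (inl (inr f) :: S); split=> [|i]; first by left.
by apply: term_over_sub (aS i) => c; right.
Qed.

Lemma form_over_exists A : exists S, form_over S A.
Proof.
have inl' (T : Type) (S S' : seq T) c : List.In c S -> List.In c (S ++ S').
  by move=> H; apply/List.in_or_app; left.
have inr' (T : Type) (S S' : seq T) c : List.In c S' -> List.In c (S ++ S').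
  by move=> H; apply/List.in_or_app; right.
have bin A1 A2 : (exists S, form_over S A1) -> (exists S, form_over S A2) ->
    exists S, form_over S A1 /\ form_over S A2.
  move=> [S HS] [S' HS']; exists (S ++ S').
  by split; [apply: form_over_sub HS|apply: form_over_sub HS'] => c; auto.
elim: A => //= [R a|s t|||A IA B IB|A IA B IB|A IA B IB]; try exact: bin.
- case: (args_over (fun i => term_over_exists (a i))) => S aS.
  exists (inl (inl R) :: S); split=> [|i]; first by left.
  by apply: term_over_sub (aS i) => c; right.
- case: (term_over_exists s) (term_over_exists t) => [S HS] [S' HS'].
  exists (S ++ S').
  by split; [apply: term_over_sub HS|apply: term_over_sub HS'] => c; auto.
- by exists [::].
- by exists [::].
Qed.

Lemma term_over_subst S r t : (forall v, term_over S (subst_var r v)) ->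
  term_over S t -> term_over S (subst_term r t).
Proof.
move=> rS; elim/term_nested_ind: t => //= f a IH [fS aS].
by split=> // i; rewrite ffunE; apply: IH.
Qed.

Lemma form_over_subst S r A : (forall v, term_over S (subst_var r v)) ->
  form_over S A -> form_over S (subst r A).
Proof.
elim: A r => //= [R a|s t|A IA B IB|A IA B IB|A IA B IB|x A IA|x A IA] r rS.
- by case=> RS aS; split=> // i; rewrite ffunE; apply: term_over_subst.
- by case=> sS tS; split; apply: term_over_subst.
1-3: by case=> /(IA _ rS) ? /(IB _ rS) ?.
all: by apply: IA => v; rewrite subst_var_set; case: eqP.
Qed.

Lemma form_over_inst S A x y : form_over S A -> form_over S (subst1 A (TVar y) x).
Proof.
apply: form_over_subst => v; rewrite subst_var_set; case: eqP => // _.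
by rewrite /subst_var fnd_fmap0.
Qed.

(** A position of [c] in [S], chosen by [epsilon] because symbols carry no decidable equality. *)
Definition sym_index S (c : symbol) : nat :=
  epsilon (inhabits 0) (fun i => List.nth_error S i = Some c).

Lemma sym_indexK S c : List.In c S -> List.nth_error S (sym_index S c) = Some c.
Proof. by move=> cS; rewrite /sym_index; apply epsilon_spec; apply: List.In_nth_error. Qed.

Lemma sym_index_inj S c c' : List.In c S -> List.In c' S ->
  sym_index S c = sym_index S c' -> c = c'.
Proof.
move=> cS cS' E; have := sym_indexK cS.
by rewrite E (sym_indexK cS') => -[].
Qed.

Notation code := (GenTree.tree nat).

(** The successor in the label of a function symbol reserves the label 0 for constants. *)
Fixpoint term_code S t : code :=
  match t with
  | TVar v => GenTree.Leaf v
  | TCst c => GenTree.Node 0 [:: GenTree.Leaf (sym_index S (inr c))]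
  | TFun f a => GenTree.Node (sym_index S (inl (inr f))).+1
                  [seq term_code S (a i) | i <- enum 'I_(fun_ar f)]
  end.

Fixpoint form_code S A : code :=
  match A with
  | FRel R a => GenTree.Node 0 (GenTree.Leaf (sym_index S (inl (inl R)))
                  :: [seq term_code S (a i) | i <- enum 'I_(rel_ar R)])
  | FEq s t => GenTree.Node 1 [:: term_code S s; term_code S t]
  | FTop => GenTree.Node 2 [::]
  | FBot => GenTree.Node 3 [::]
  | FAnd A B => GenTree.Node 4 [:: form_code S A; form_code S B]
  | FOr A B => GenTree.Node 5 [:: form_code S A; form_code S B]
  | FImp A B => GenTree.Node 6 [:: form_code S A; form_code S B]
  | FAll x A => GenTree.Node 7 [:: GenTree.Leaf x; form_code S A]
  | FEx x A => GenTree.Node 8 [:: GenTree.Leaf x; form_code S A]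
  end.

Lemma map_enum_inj n (T : Type) (g h : 'I_n -> T) :
  [seq g i | i <- enum 'I_n] = [seq h i | i <- enum 'I_n] -> g =1 h.
Proof.
move=> E i; have: i \in enum 'I_n by rewrite mem_enum.
elim: (enum 'I_n) E => //= j l IH [gh /IH {}IH].
by rewrite inE => /orP[/eqP ->|/IH].
Qed.

Lemma term_code_inj S t t' : term_over S t -> term_over S t' ->
  term_code S t = term_code S t' -> t = t'.
Proof.
elim/term_nested_ind: t t' => [v|c|f a IH] [v'|c'|f' a'] //=.
- by move=> _ _ [->].
- by move=> cS cS' [] /(sym_index_inj cS cS') [->].
- move=> [fS aS] [fS' aS'] [] /(sym_index_inj fS fS') [E]; subst f'.
  move=> /map_enum_inj aa'; congr TFun; apply/ffunP => i.
  by apply: IH => //; apply: aa'.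
Qed.

Lemma form_code_inj S A A' : form_over S A -> form_over S A' ->
  form_code S A = form_code S A' -> A = A'.
Proof.
elim: A A' => [R a|s t|||A IA B IB|A IA B IB|A IA B IB|x A IA|x A IA]
  [R' a'|s' t'|||A' B'|A' B'|A' B'|x' A'|x' A'] //=.
- move=> [RS aS] [RS' aS'] [] /(sym_index_inj RS RS') [E]; subst R'.
  move=> /map_enum_inj aa'; congr FRel; apply/ffunP => i.
  by apply: term_code_inj (aa' i).
- move=> [sS tS] [sS' tS'] [].
  by move=> /(term_code_inj sS sS') -> /(term_code_inj tS tS') ->.
1-3: by move=> [AS BS] [AS' BS'] [] /(IA _ AS AS') -> /(IB _ BS BS') ->.
all: by move=> AS AS' [-> /(IA _ AS AS') ->].
Qed.

(** * A maximal consistent Henkin theory *)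

Variable S : seq symbol.

(** A number that codes no formula over [S] receives an arbitrary formula; only surjectivity onto
    the formulas over [S] is needed. *)
Definition form_enum (n : nat) : form L :=
  epsilon (inhabits FTop) (fun A => form_over S A /\ choice.pickle (form_code S A) = n).

Lemma form_enum_surj A : form_over S A -> exists n, form_enum n = A.
Proof.
move=> AS; exists (choice.pickle (form_code S A)); rewrite /form_enum.
have [AS' E] := epsilon_spec (inhabits FTop)
  (fun B => form_over S B /\ choice.pickle (form_code S B) = choice.pickle (form_code S A))
  (ex_intro _ A (conj AS erefl)).
by apply: form_code_inj AS' AS _; apply: (pcan_inj choice.pickleK).
Qed.

Definition inconsistent C := fo_provable (FImp C FBot).

(** A stage is a single formula, the conjunction of what has been accepted. It has finitely many
    free variables, so a fresh variable can witness the failure of a rejected universal formula,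
    without new constants. *)
Definition henkin_step C A : form L :=
  if excluded_middle_informative (inconsistent (FAnd C A)) then
    match A with
    | FAll x B =>
        FAnd C (FNot (subst1 B (TVar (fresh (fv C `|` fv B))) x))
    | _ => C
    end
  else FAnd C A.

Lemma henkin_step_imp C A : fo_provable (FImp (henkin_step C A) C).
Proof.
apply: fo_taut; rewrite /henkin_step; case: excluded_middle_informative => /= [_|_]; last by taut.
by case: A; intros; taut.
Qed.

(** Generalize over the fresh [y], rename it to [x], distribute the quantifier, and use that it is
    vacuous on [C]. *)
Lemma fo_imp_all C x y B : y \notin fv C -> y \notin fv B ->
  fo_provable (FImp C (subst1 B (TVar y) x)) -> fo_provable (FImp C (FAll x B)).
Proof.
move=> yC yB /(fo_provable_gen y) H.
apply: (@fo_alpha _ (FImp C (FAll y (subst1 B (TVar y) x)))).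
  by apply: aeq_imp; [exact: aeq_refl|apply: aeq_sym; exact: aeq_rename_all].
have {}H := fo_mp (fo_ax (ax_dist _ _ _)) H.
by apply: fo_taut2 (fo_ax (ax_vac yC)) H; taut.
Qed.

(** If adding the negated instance were inconsistent, [C] would prove the instance at a fresh
    variable, hence the universal formula, which [C] refutes. *)
Lemma henkin_step_consistent C A :
  ~ inconsistent C -> ~ inconsistent (henkin_step C A).
Proof.
rewrite /henkin_step; case: excluded_middle_informative => //.
case: A => //= x B CA CC H; apply: CC.
set y := fresh _ in H; have /norP[yC yB] : ~~ ((y \in fv C) || (y \in fv B)).
  by rewrite -in_fsetU fresh_notin.
have /(fo_imp_all yC yB) CB : fo_provable (FImp C (subst1 B (TVar y) x)).
  by apply: fo_taut1 H; taut.
by apply: fo_taut2 CA CB; taut.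
Qed.

Variable C0 : form L.
Hypothesis C0_consistent : ~ inconsistent C0.

Fixpoint stage n : form L :=
  if n is m.+1 then henkin_step (stage m) (form_enum m) else C0.

(** The deductive closure of the increasing chain of stages. *)
Definition theory A : Prop := exists n, fo_provable (FImp (stage n) A).

Lemma stage_consistent n : ~ inconsistent (stage n).
Proof. by elim: n => //= n; apply: henkin_step_consistent. Qed.

Lemma stage_mono m n : m <= n -> fo_provable (FImp (stage n) (stage m)).
Proof.
move=> /subnK <-; elim: (n - m) => [|k IH]; first by apply: fo_taut; taut.
rewrite addSn.
by apply: fo_taut2 (henkin_step_imp (stage (k + m)) (form_enum (k + m))) IH; taut.
Qed.

Lemma theory_fo A : fo_provable A -> theory A.
Proof. by move=> H; exists 0; apply: fo_taut1 H; taut. Qed.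

Lemma theory_mp A B : theory (FImp A B) -> theory A -> theory B.
Proof.
move=> [m HAB] [n HA]; exists (maxn m n).
have Hm := stage_mono (leq_maxl m n); have Hn := stage_mono (leq_maxr m n).
have {}HAB : fo_provable (FImp (stage (maxn m n)) (FImp A B)).
  by apply: fo_taut2 Hm HAB; taut.
have {}HA : fo_provable (FImp (stage (maxn m n)) A).
  by apply: fo_taut2 Hn HA; taut.
by apply: fo_taut2 HAB HA; taut.
Qed.

Lemma theory_taut1 A B : tautology (FImp A B) -> theory A -> theory B.
Proof. by move=> /fo_taut /theory_fo; apply: theory_mp. Qed.

Lemma theory_taut2 A B C : tautology (FImp A (FImp B C)) ->
  theory A -> theory B -> theory C.
Proof. by move=> tA /(theory_taut1 tA); apply: theory_mp. Qed.

Lemma theory_C0 : theory C0.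
Proof. by exists 0; apply: fo_taut; taut. Qed.

Lemma theory_consistent A : theory A -> theory (FNot A) -> False.
Proof.
move=> TA TnA; have [n] : theory FBot by apply: theory_mp TnA TA.
exact: stage_consistent.
Qed.

Lemma theory_complete A : form_over S A -> theory A \/ theory (FNot A).
Proof.
move=> /form_enum_surj [n En].
case: (classic (inconsistent (FAnd (stage n) A))) => H.
  by right; exists n; apply: fo_taut1 H; taut.
left; exists n.+1; rewrite /= /henkin_step En.
by case: excluded_middle_informative => //= ?; apply: fo_taut; taut.
Qed.

Lemma theory_witness x B : form_over S B -> ~ theory (FAll x B) ->
  exists y, theory (FNot (subst1 B (TVar y) x)).
Proof.
move=> BS nT; have [n En] := form_enum_surj (A := FAll x B) BS.
exists (fresh (fv (stage n) `|` fv B)); exists n.+1.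
rewrite /= /henkin_step En; case: excluded_middle_informative => H.
  by apply: fo_taut; taut.
(* Had the universal formula been consistent with its stage, it would have been accepted. *)
case: nT; exists n.+1; rewrite /= /henkin_step En.
by case: excluded_middle_informative => //= ?; apply: fo_taut; taut.
Qed.

Lemma theory_not A : form_over S A -> theory (FNot A) <-> ~ theory A.
Proof.
move=> AS; split; first by move=> TnA TA; apply: theory_consistent TA TnA.
by case: (theory_complete AS).
Qed.

Lemma theory_and A B : theory (FAnd A B) <-> theory A /\ theory B.
Proof.
split; last by case; apply: theory_taut2; taut.
by move=> T; split; apply: theory_taut1 T; taut.
Qed.

Lemma theory_or A B : form_over S A -> theory (FOr A B) <-> theory A \/ theory B.
Proof.
move=> AS; split; last by case; apply: theory_taut1; taut.
move=> TAB; case: (theory_complete AS) => TA; [by left|right].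
by apply: theory_taut2 TAB TA; taut.
Qed.

Lemma theory_imp A B : form_over S A -> theory (FImp A B) <-> (theory A -> theory B).
Proof.
move=> AS; split; first exact: theory_mp.
move=> TAB; case: (theory_complete AS) => TA.
  by apply: theory_taut1 (TAB TA); taut.
by apply: theory_taut1 TA; taut.
Qed.

Lemma theory_inst x t B : theory (FAll x B) -> theory (subst1 B t x).
Proof. by apply: theory_mp; apply/theory_fo/fo_ax/ax_inst. Qed.

Lemma theory_ex x B : theory (FEx x B) <-> theory (FNot (FAll x (FNot B))).
Proof.
have T : theory _ := theory_fo (fo_ax (ax_ex x B)).
by split; apply: theory_mp; apply: theory_taut1 T; taut.
Qed.

(** * Equality and congruence in the theory *)

Lemma theory_refl t : theory (FEq t t).
Proof. by apply/theory_fo/fo_ax/ax_refl. Qed.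

Lemma theory_leibniz s t x A : theory (FEq s t) ->
  theory (subst1 A s x) -> theory (subst1 A t x).
Proof.
by move=> T; apply: theory_mp; apply: theory_mp T; apply/theory_fo/fo_ax/ax_leibniz.
Qed.

(** Leibniz in the context [x = s], with [x] fresh for [s], turns [s = s] into [t = s]. *)
Lemma theory_sym s t : theory (FEq s t) -> theory (FEq t s).
Proof.
move=> T; set x := fresh (fv_term s).
have := theory_leibniz (x := x) (A := FEq (TVar x) s) T.
rewrite /subst1 /= !(subst_term_fresh _ (fresh_notin _)) !subst_var_set eqxx.
by apply; apply: theory_refl.
Qed.

Lemma theory_trans s t u : theory (FEq s t) -> theory (FEq t u) -> theory (FEq s u).
Proof.
move=> Tst Ttu; set x := fresh (fv_term s).
have := theory_leibniz (x := x) (A := FEq s (TVar x)) Ttu.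
rewrite /subst1 /= !(subst_term_fresh _ (fresh_notin _)) !subst_var_set eqxx.
by apply.
Qed.

(* [P] is an atomic context with n argument places; the arguments are replaced
   one after the other. *)
Lemma theory_congr n (P : {ffun 'I_n -> term L} -> form L) (V : {fset var})
    (a b : {ffun 'I_n -> term L}) :
  (forall x t c, x \notin V ->
     subst1 (P c) t x = P (subst_args [fmap].[x <- t] c)) ->
  (forall i, theory (FEq (a i) (b i))) -> theory (P a) -> theory (P b).
Proof.
move=> Psub ab Pa.
(* [mix k] has its first [k] arguments already replaced, going from [a] at 0 to [b] at [n]. *)
pose mix k := [ffun i : 'I_n => if i < k then b i else a i].
suff: theory (P (mix n)).
  by congr (theory (P _)); apply/ffunP => i; rewrite ffunE ltn_ord.
have: n <= n by []; elim: {-2}n => [_|k IH kn].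
  by move: Pa; congr (theory (P _)); apply/ffunP => i; rewrite ffunE ltn0.
pose x := fresh (V `|` (fv_args a `|` fv_args b)).
have [xV xa xb] : [/\ x \notin V, x \notin fv_args a & x \notin fv_args b].
  by have := fresh_notin (V `|` (fv_args a `|` fv_args b)); rewrite !inE !negb_or => /and3P.
pose i0 := Ordinal kn.
(* The context with a hole at place [k]: filling it with [a i0] gives [mix k], with [b i0] gives
   [mix k.+1]. *)
pose c := [ffun i : 'I_n => if i == i0 then TVar x else mix k i].
have csub t j : subst_args [fmap].[x <- t] c j = if j == i0 then t else mix k j.
  rewrite !ffunE; case: eqP => [_|_]; first by rewrite /= subst_var_set eqxx.
  apply: subst_term_fresh; case: ifP => _.
    by apply: contra xb; apply/fsubsetP/fv_args_sub.
  by apply: contra xa; apply/fsubsetP/fv_args_sub.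
have := theory_leibniz (x := x) (A := P c) (ab i0); rewrite !Psub //.
have -> : subst_args [fmap].[x <- a i0] c = mix k.
  by apply/ffunP => j; rewrite csub; case: eqP => // ->; rewrite ffunE ltnn.
have -> : subst_args [fmap].[x <- b i0] c = mix k.+1.
  apply/ffunP => j; rewrite csub !ffunE (ltnS j k) (leq_eqVlt j k) -(inj_eq val_inj) /=.
  by case: eqP => //= jk; have -> : j = i0 by apply: val_inj.
by apply; apply: IH; apply: ltnW.
Qed.

Lemma theory_congr_rel R (a b : {ffun 'I_(rel_ar R) -> term L}) :
  (forall i, theory (FEq (a i) (b i))) -> theory (FRel a) -> theory (FRel b).
Proof. by apply: (theory_congr (V := fset0)). Qed.

Lemma theory_congr_fun f (a b : {ffun 'I_(fun_ar f) -> term L}) :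
  (forall i, theory (FEq (a i) (b i))) -> theory (FEq (TFun a) (TFun b)).
Proof.
(* The left side stays fixed, so the hole variable has to avoid its free variables. *)
move=> ab; apply: (theory_congr (P := fun c => FEq (TFun a) (TFun c))
  (V := fv_term (TFun a))) ab (theory_refl _) => x t c xa.
by rewrite /subst1 [LHS]/= -[TFun [ffun i => _]]/(subst_term _ (TFun a)) subst_term_fresh.
Qed.

(** * The term model *)

(* Thanks to the Henkin witnesses every term is equal to a variable, so the
   domain consists of one variable for each class. *)
Lemma theory_eq_var t : term_over S t -> exists w, theory (FEq t (TVar w)).
Proof.
move=> tS; pose x := fresh (fv_term t).
(* The theory cannot contain that all [x] differ from [t], since the instance at [t] contradicts
   reflexivity; a Henkin witness of this failure is equal to [t]. *)
have [w] : exists w,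
    theory (FNot (subst1 (FNot (FEq t (TVar x))) (TVar w) x)).
  apply: theory_witness => // /(@theory_inst _ t); rewrite /subst1 /= subst_term_fresh ?fresh_notin //.
  by rewrite subst_var_set eqxx; apply: theory_consistent; apply: theory_refl.
rewrite /subst1 /= subst_term_fresh ?fresh_notin // subst_var_set eqxx => T.
by exists w; apply: theory_taut1 T; taut.
Qed.

Definition repr (v : var) : var :=
  epsilon (inhabits 0) (fun w => theory (FEq (TVar v) (TVar w))).

Lemma theory_repr v : theory (FEq (TVar v) (TVar (repr v))).
Proof. by rewrite /repr; apply epsilon_spec; exists v; apply: theory_refl. Qed.

(** Equal variables define extensionally equal predicates, on which [epsilon] makes the same
    choice. *)
Lemma repr_eq v w : theory (FEq (TVar v) (TVar w)) -> repr v = repr w.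
Proof.
move=> T; rewrite /repr; congr epsilon; apply: functional_extensionality => u.
apply: propositional_extensionality; split; apply: theory_trans => //.
exact: theory_sym.
Qed.

Lemma repr_idem v : repr (repr v) == repr v.
Proof. by apply/eqP/repr_eq/theory_sym/theory_repr. Qed.

Definition term_dom : Type := {v : var | repr v == v}.

Definition cls (v : var) : term_dom := exist _ (repr v) (repr_idem v).

Lemma cls_val (d : term_dom) : cls (val d) = d.
Proof. by apply: val_inj; apply/eqP; apply: (valP d). Qed.

Lemma cls_eq v w : cls v = cls w <-> theory (FEq (TVar v) (TVar w)).
Proof.
split; last by move=> T; apply: val_inj; apply: repr_eq.
move=> /(congr1 val) /= E; apply: theory_trans (theory_repr v) _.
by rewrite E; apply/theory_sym/theory_repr.
Qed.

(** Total by arbitrary choice; it is meaningful for terms over [S], which equal some variable. *)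
Definition term_cls t : term_dom :=
  cls (epsilon (inhabits 0) (fun w => theory (FEq t (TVar w)))).

Lemma theory_term_cls t : term_over S t -> theory (FEq t (TVar (val (term_cls t)))).
Proof.
move=> /theory_eq_var /(epsilon_spec (inhabits 0)) T.
exact: theory_trans T (theory_repr _).
Qed.

Definition term_model : model L := {|
  rel_i R (b : {ffun 'I_(rel_ar R) -> term_dom}) :=
    theory (FRel [ffun i => TVar (val (b i))]);
  fun_i f (b : {ffun 'I_(fun_ar f) -> term_dom}) :=
    term_cls (TFun [ffun i => TVar (val (b i))]);
  cst_i c := term_cls (TCst c)
|}.

(** * The truth lemma *)

Lemma theory_eval t : term_over S t ->
  theory (FEq t (TVar (val (@eval L term_model cls t : term_dom)))).
Proof.
elim/term_nested_ind: t => /= [v _|c|f a IH [fS aS]].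
- exact: theory_repr.
- exact: (@theory_term_cls (TCst c)).
- set b := [ffun i => TVar _].
  apply: (@theory_trans _ (TFun b)); last first.
    by apply: theory_term_cls; split=> // i; rewrite ffunE.
  by apply: theory_congr_fun => i; rewrite !ffunE; apply: IH.
Qed.

Lemma truth n A : form_size A < n -> form_over S A ->
  theory A <-> @sat L term_model cls A.
Proof.
elim: n A => // n IH [R a|s t|||A B|A B|A B|x A|x A] /=; rewrite ltnS.
- move=> _ [RS aS].
  have E i : theory (FEq (a i) ([ffun i => TVar (val
      ([ffun i => @eval L term_model cls (a i)] i : term_dom))] i)).
    by rewrite !ffunE; apply: theory_eval.
  split; apply: theory_congr_rel => i; first exact: E.
  exact/theory_sym/E.
- move=> _ [sS tS]; split=> [T|E].
    rewrite -[LHS]cls_val -[RHS]cls_val; apply/cls_eq.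
    apply: theory_trans (theory_eval tS).
    by apply: theory_trans T; apply/theory_sym/theory_eval.
  apply: theory_trans (theory_eval sS) _; rewrite E.
  exact/theory_sym/theory_eval.
- by move=> _ _; split=> // _; apply: theory_fo; apply: fo_taut; taut.
- move=> _ _; split=> // T; apply: theory_consistent T _.
  by apply: theory_fo; apply: fo_taut; taut.
1-3: move=> ABn [AS BS].
1-3: have IA : theory A <-> @sat L term_model cls A by
       apply: IH => //; apply: leq_ltn_trans ABn; apply: leq_addr.
1-3: have IB : theory B <-> @sat L term_model cls B by
       apply: IH => //; apply: leq_ltn_trans ABn; apply: leq_addl.
- by rewrite theory_and IA IB.
- by rewrite theory_or // IA IB.
- by rewrite theory_imp // IA IB.
all: move=> An AS.
(* Instances at variables have smaller size, and each domain element is the class of a variable, so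
   these instances exhaust the quantifier. *)
all: have I v : theory (subst1 A (TVar v) x) <-> @sat L term_model (@upd L term_model cls x (cls v)) A
  by rewrite IH ?form_size_subst ?sat_subst1 //; apply: form_over_inst.
- split=> [T d|H].
    by rewrite -(cls_val d); apply/I/theory_inst.
  apply: NNPP => /(theory_witness AS) [y]; apply: theory_consistent.
  exact/I/H.
- rewrite theory_ex theory_not //; split=> [/theory_witness [] // y T|[d Hd] T].
    (* The witness comes as a doubly negated instance. *)
    by exists (cls y); apply/I; apply: theory_taut1 T; rewrite /subst1 /=; taut.
  move: Hd; rewrite -(cls_val d) => /I; move/theory_consistent; apply.
  exact: (theory_inst (TVar (val d)) T).
Qed.

End Completeness.

(** * Completeness and conservativity *)

Theorem fo_complete (L : signature) (A : form L) :
  (forall (M : model L) (e : var -> dom M), sat e A) -> fo_provable A.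
Proof.
move=> valA; apply: NNPP => nA.
have con : ~ inconsistent (FNot A).
  by move=> H; apply: nA; apply: fo_taut1 H => val /=; case: (prop_eval val A).
have [S AS] := form_over_exists A.
(* Validity in the term model of a theory built from the negation of [A] puts [A] itself in that
   theory. *)
have AT : theory S (FNot A) A by apply/(truth con (leqnn _) AS)/valA.
exact: (theory_consistent con AT (theory_C0 _ _)).
Qed.

Theorem mainTheorem3 (L : signature) (A : form L) (F : {fset var}) :
  fv A `<=` F ->
  derivable (PForm (MTop F) ⊢[F] SForm (kappa F A)) ->
  fo_provable A.
Proof.
move=> _ D; apply: fo_complete => M e.
(* [I] proves the antecedent, which translates to [True]. *)
by have := @derivable_valid L M _ D e I; rewrite /= tau_kappa.
Qed.
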